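(* Let $\nu\ge0$, $0<\beta\le1$, $\alpha>0$, $t\ge0$ and $n\in\{0,1,2,\ldots\}$. The probability mass function $\widetilde\eta_\beta(n|t,\alpha,p)=\mathbb{P}[\widetilde W^\Gamma_\beta(t)=n]$ of the space fractional Polya process satisfies the following fractional differential equation in the variable $p>0$: $$\partial_p^\nu\widetilde\eta_\beta(n|t,\alpha,p)=\partial_p^{\nu-1}\big[(\log(\alpha)-\psi(p))\,\widetilde\eta_\beta(n|t,\alpha,p)\big]+\int_0^\infty\widetilde p_\beta(n|t,\lambda)\,\log(\lambda)\,\partial_p^{\nu-1}g(\lambda|\alpha,p)\,d\lambda,$$ where $\widetilde\eta_\beta(n|0,\alpha,p)=1$ if $n=0$ and zero otherwise.
   Context: $\psi(x)=\Gamma'(x)/\Gamma(x)$ is the digamma function. $\{D_\beta(t)\}_{t\ge0}$ is the $\beta$-stable subordinator, $\mathbb{E}[e^{-sD_\beta(t)}]=e^{-ts^\beta}$ ($D_1(t)=t$); $\{N(t,\lambda)\}_{t\ge0}$ is a Poisson process of rate $\lambda$, independent of $D_\beta$; $\Gamma$ is a random variable with the gamma density $g(y|\alpha,p)=\frac{\alpha^p}{\Gamma(p)}y^{p-1}e^{-\alpha y}$, $y>0$ (and $g(y|\alpha,0)=0$), independent of $\{D_\beta(t)\}$ and $\{N(t,\lambda)\}$. The space fractional Poisson process is $\widetilde N_\beta(t,\lambda)=N(D_\beta(t),\lambda)$, with pmf $\widetilde p_\beta(n|t,\lambda)=\mathbb{P}[\widetilde N_\beta(t,\lambda)=n]=\frac{(-1)^n}{n!}\sum_{k=0}^\infty\frac{(-\lambda^\beta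 t)^k}{k!}\frac{\Gamma(\beta k+1)}{\Gamma(\beta k+1-n)}$. The space fractional Polya process (SFPP) is $\widetilde W^\Gamma_\beta(t)=\widetilde N_\beta(t,\Gamma)$, so $\widetilde\eta_\beta(n|t,\alpha,p)=\int_0^\infty\widetilde p_\beta(n|t,\lambda)g(\lambda|\alpha,p)\,d\lambda$. Riemann–Liouville derivative in $p$: for an integer $m\ge1$, $\partial_p^\nu f(p)=\frac{1}{\Gamma(m-\nu)}\frac{d^m}{dp^m}\int_0^p\frac{f(s)}{(p-s)^{\nu-m+1}}ds$ if $m-1<\nu<m$, $\partial_p^mf=\frac{d^m}{dp^m}f$, $\partial_p^0f=f$; for negative order $-\mu<0$, $\partial_p^{-\mu}f(p)=\frac{1}{\Gamma(\mu)}\int_0^p(p-s)^{\mu-1}f(s)\,ds$ (Riemann–Liouville integral).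
   Formalization: For n=0 with ν=0 or ν non-integer the right-hand side diverges, since (log α−ψ(s))η behaves like 1/s at 0; the equation is asserted exactly when n≥1 or ν is a positive integer, and the right-hand side is shown undefined otherwise. *)

(* Defs.v *)
From HB Require Import structures.
From mathcomp Require Import all_boot all_order all_algebra.
From mathcomp Require Import all_classical all_reals all_analysis.
Set Implicit Arguments.
Unset Strict Implicit.
Unset Printing Implicit Defensive.
Import Order.TTheory GRing.Theory Num.Theory.
Import numFieldNormedType.Exports.
Local Open Scope classical_set_scope.
Local Open Scope ring_scope.

(* Euler's Gamma function; meaningful for x > 0. *)
Definition Gamma_fun (R : realType) (x : R) : R :=
  \int[lebesgue_measure]_(y in `]0, +oo[) (y `^ (x - 1) * expR (- y)).

Definition digamma (R : realType) (x : R) : R :=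
  derive1 (@Gamma_fun R) x / Gamma_fun x.

(* Density g(y | alpha, p), extended by 0 to y <= 0 and to p <= 0. *)
Definition gamma_density (R : realType) (y alpha p : R) : R :=
  if (0 < y) && (0 < p) then
    alpha `^ p / Gamma_fun p * y `^ (p - 1) * expR (- (alpha * y))
  else 0.

Definition RL_integral (R : realType) (mu : R) (f : R -> R) (p : R) : R :=
  (Gamma_fun mu)^-1 *
  \int[lebesgue_measure]_(s in `]0, p[) ((p - s) `^ (mu - 1) * f s).

(* Order nu in ]m - 1, m[ *)
Definition RL_kernel (R : realType) (m : nat) (nu : R) (f : R -> R) (q : R) : R :=
  \int[lebesgue_measure]_(s in `]0, q[) (f s / (q - s) `^ (nu - m%:R + 1)).

(* For nu >= 0 that is not an integer, m = (Num.truncn nu).+1 is the integer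
   such that m - 1 < nu < m. *)
Definition RL_deriv (R : realType) (nu : R) (f : R -> R) (p : R) : R :=
  if nu < 0 then RL_integral (- nu) f p
  else let k := Num.truncn nu in
    if nu == k%:R then derive1n k f p
    else (Gamma_fun (k.+1%:R - nu))^-1 * derive1n k.+1 (RL_kernel k.+1 nu f) p.

(* The integral and the derivative of the library are total operators, with
   a default value when they do not exist; the next two predicates say that
   the objects in RL_deriv nu f p really exist.  They matter for the equation
   of the space fractional Polya process: as p -> 0+ its pmf eta tends to 1
   for n = 0 and to 0 for n > 0, while digamma p ~ - 1 / p.  For n = 0 the
   function (ln alpha - digamma s) * eta s is therefore not integrable at 0,
   and its Riemann-Liouville derivative of order nu - 1 does not exist unless
   nu is one of 1, 2, 3, ... *)
Definition nderivable (R : realType) (m : nat) (f : R -> R) (p : R) : Prop :=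
  forall k : nat, (k < m)%N -> \forall q \near p, derivable (derive1n k f) q 1.

Definition RL_exists (R : realType) (nu : R) (f : R -> R) (p : R) : Prop :=
  if nu < 0 then
    (lebesgue_measure.-integrable `]0, p[
      (fun s : R => ((p - s) `^ (- nu - 1) * f s)%:E) : Prop)
  else let k := Num.truncn nu in
    if nu == k%:R then nderivable k f p
    else (\forall q \near p, lebesgue_measure.-integrable `]0, q[
            (fun s : R => (f s / (q - s) `^ (nu - k.+1%:R + 1))%:E)) /\
         nderivable k.+1 (RL_kernel k.+1 nu f) p.

(* Processes are indexed by all reals, but only times t >= 0 are constrained. *)

Definition independent_increments d (T : measurableType d) (R : realType)
    (P : probability T R) (X : R -> T -> R) : Prop :=
  forall (k : nat) (u : nat -> R) (B : nat -> set R),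
    (forall i, 0 <= u i <= u i.+1) -> (forall i, measurable (B i)) ->
    fine (P (\bigcap_(i in `I_k) [set w | B i (X (u i.+1) w - X (u i) w)])) =
    \prod_(i < k) fine (P [set w | B i (X (u i.+1) w - X (u i) w)]).

Definition monotone_rc_paths d (T : measurableType d) (R : realType)
    (P : probability T R) (X : R -> T -> R) : Prop :=
  {ae P, forall w,
    (forall s t : R, 0 <= s -> s <= t -> X s w <= X t w) /\
    (forall t : R, 0 <= t -> X s w @[s --> t^'+] --> X t w)}.

(* For beta = 1 the Laplace transform forces D t = t almost surely. *)
Definition stable_subordinator d (T : measurableType d) (R : realType)
    (P : probability T R) (beta : R) (D : R -> {RV P >-> R}) : Prop :=
  [/\ {ae P, forall w, D 0 w = 0},
      independent_increments P D,
      forall (s t : R) (B : set R), 0 <= s -> s <= t -> measurable B ->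
        P [set w | B (D t w - D s w)] = P [set w | B (D (t - s) w)],
      monotone_rc_paths P D &
      forall t s : R, 0 <= t -> 0 < s ->
        ('E_P[fun w => (expR (- s * D t w))%R] = (expR (- t * s `^ beta))%:E)%E].

Definition poisson_process d (T : measurableType d) (R : realType)
    (P : probability T R) (lambda : R) (N : R -> {RV P >-> nat}) : Prop :=
  [/\ {ae P, forall w, N 0 w = 0%N},
      independent_increments P (fun t w => (N t w)%:R),
      forall (s t : R) (k : nat), 0 <= s -> s < t ->
        P [set w | N t w = (N s w + k)%N] =
        (poisson_pmf (lambda * (t - s)) k)%:E &
      monotone_rc_paths P (fun t w => (N t w)%:R)].

Definition family_generators (I : Type) d d' (T : measurableType d)
    (T' : measurableType d') (J : set I) (X : I -> T -> T') : set (set T) :=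
  \bigcup_(i in J) preimage_set_system setT (X i) measurable.

(* Independence of sigma-algebras; F, G and H are only generators. *)
Definition independent3 d (T : measurableType d) (R : realType)
    (P : probability T R) (F G H : set (set T)) : Prop :=
  forall A B C : set T, <<s F >> A -> <<s G >> B -> <<s H >> C ->
    P (A `&` B `&` C) = (P A * P B * P C)%E.

(* N t lambda is a random field whose value at the random point
   (D t, Gamma) has to be taken.  The families N ^~ lambda do not determine
   the law of N (D t) Gamma unless N is jointly measurable in (t, lambda, w)
   for the sigma-algebra that N itself generates; e.g. N t lambda =
   N1 (lambda * t) for a rate one process N1. *)
Definition N_generators d (T : measurableType d) (R : realType)
    (P : probability T R) (N : R -> R -> {RV P >-> nat}) : set (set T) :=
  family_generators setT (fun x : R * R => N x.1 x.2 : T -> nat).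

Definition jointly_measurable_field d (T : measurableType d) (R : realType)
    (P : probability T R) (N : R -> R -> {RV P >-> nat}) : Prop :=
  measurable_fun setT
    (fun x : (R * R) * g_sigma_algebraType (N_generators N) =>
       N x.1.1 x.1.2 x.2).

Definition gamma_distributed d (T : measurableType d) (R : realType)
    (P : probability T R) (alpha p : R) (G : {RV P >-> R}) : Prop :=
  forall B : set R, measurable B ->
    distribution P G B =
    (\int[lebesgue_measure]_(y in B) (gamma_density y alpha p)%:E)%E.

Definition sf_poisson d (T : measurableType d) (R : realType)
    (P : probability T R) (D : R -> {RV P >-> R}) (N : R -> R -> {RV P >-> nat})
    (t lambda : R) (w : T) : nat := N (D t w) lambda w.

Definition sf_polya d (T : measurableType d) (R : realType)
    (P : probability T R) (D : R -> {RV P >-> R}) (N : R -> R -> {RV P >-> nat})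
    (G : {RV P >-> R}) (t : R) (w : T) : nat := sf_poisson D N t (G w) w.

Definition pmf_at d (T : measurableType d) (R : realType)
    (P : probability T R) (X : T -> nat) (n : nat) : R :=
  fine (P [set w | X w = n]).

(* Main.v *)
Require Import Defs.
From HB Require Import structures.
From mathcomp Require Import all_boot all_order all_algebra.
From mathcomp Require Import all_classical all_reals all_analysis.
From mathcomp Require Import measurable_realfun ring lra.
Set Implicit Arguments.
Unset Strict Implicit.
Unset Printing Implicit Defensive.
Import Order.TTheory GRing.Theory Num.Theory.
Import numFieldNormedType.Exports.
Local Open Scope classical_set_scope.
Local Open Scope ring_scope.

(** Given the intensity [l], let [h l] be the probability that the space
    fractional Poisson process is at [n] at time [t].  Conditioning on the gamma
    intensity gives [eta t p = \int h l * gamma_density l alpha p]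
    ([sf_polya_mixture]).  The density is [c p * l `^ (p - 1) * expR (- alpha l)]
    with [c p = alpha `^ p / Gamma p], so [eta t = c * M], where [M] is the
    Mellin transform of [h l * expR (- alpha l)].  Now
    [c' = (ln alpha - digamma) * c], and a derivative of the kernel in [p] brings
    out a factor [ln l].  Hence
    [eta' = (ln alpha - digamma) * eta + \int h l * ln l * gamma_density l],
    and the equation of the theorem is the derivative of order [nu - 1] of this
    identity.  It has to be shown that this derivative of [eta'] is the
    derivative of order [nu] of [eta], and that it may be taken under the
    integral over [l].

    If [nu] is a positive integer, all derivatives are ordinary ones at [p > 0]
    and dominated convergence suffices ([mixture_equation_nat]).

    For the other orders the behaviour at [p = 0] matters.  The void probability
    of the process is the Laplace transform of the subordinator,
    [expR (- t * l `^ beta)], so for [0 < n] one has [h l <= t * l `^ beta], and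
    [M] is smooth on ]- beta, +oo[ ([dseq_Mellin]).  The factor [c] is smooth on
    ]-1, +oo[ and vanishes at [0], because [1 / Gamma] does.  Therefore [eta]
    extends to a smooth function on a neighbourhood of [[0, +oo[] which vanishes
    at [0].  For a function smooth up to the origin the derivative of a
    fractional integral is the fractional integral of the derivative plus a
    boundary term proportional to the value at the origin
    ([is_derive_frac_int]); the value of [eta] there is [0], so the orders add
    up.  The exchange with the integral over [l] is Fubini ([frac_deriv_Mellin]),
    and together they give [mixture_equation_frac].

    For [n = 0] one has [1 - h l <= t * l `^ beta] instead, so [eta] tends to [1]
    at the origin while [- digamma p] behaves like [1 / p].  Their product is
    not integrable, and the right-hand side is undefined unless [nu] is a
    positive integer ([mixture_singular]). *)

(** * Functions with all their derivatives *)

Section derivative_sequences.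
Context {R : realType}.
Implicit Types (x a b : R) (n k : nat).

Lemma is_derive_mulr (f g : R -> R) x a b :
  is_derive x 1 f a -> is_derive x 1 g b ->
  is_derive x 1 (fun y => f y * g y) (a * g x + f x * b).
Proof.
move=> fa gb; have := is_deriveM fa gb; rewrite /GRing.scale/= => h.
by apply: is_derive_eq; rewrite addrC (mulrC (g x)).
Qed.

Lemma is_derive_addr (f g : R -> R) x a b :
  is_derive x 1 f a -> is_derive x 1 g b ->
  is_derive x 1 (fun y => f y + g y) (a + b).
Proof. by move=> fa gb; exact: is_deriveD. Qed.

Lemma near_gt x0 x : x0 < x -> \forall y \near x, x0 < y.
Proof. by move=> ?; exact: lt_nbhsr. Qed.

Lemma eq_gt_is_derive (f g : R -> R) x0 x a : x0 < x ->
  (forall y, x0 < y -> f y = g y) -> is_derive x 1 f a -> is_derive x 1 g a.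
Proof.
move=> x0x fg; apply: near_eq_is_derive.
by near=> y; apply: fg; near: y; exact: near_gt.
Unshelve. all: by end_near. Qed.

(** A function is carried around with the sequence of its derivatives, so that
    smoothness is one hypothesis and no derivative is ever chosen. *)
Definition dseq x0 (f : nat -> R -> R) : Prop :=
  forall j x, x0 < x -> is_derive x 1 (f j) (f j.+1 x).

Definition shift_seq (f : nat -> R -> R) : nat -> R -> R := fun j => f j.+1.

Lemma dseq_shift x0 f : dseq x0 f -> dseq x0 (shift_seq f).
Proof. by move=> df j; exact: df. Qed.

Lemma dseq_le x0 x1 f : x0 <= x1 -> dseq x0 f -> dseq x1 f.
Proof. by move=> ? df j x x1x; apply: df; exact: le_lt_trans x1x. Qed.

Lemma dseq_derive1n x0 f F : dseq x0 f -> (forall x, x0 < x -> F x = f 0 x) ->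
  forall j x, x0 < x -> derive1n j F x = f j x.
Proof.
move=> df Ff; elim=> [|j ih] x x0x; first exact: Ff.
rewrite derive1nS derive1E.
have := eq_gt_is_derive x0x (fun y yx => esym (ih y yx)) (df j x x0x).
by case.
Qed.

Lemma dseq_derivable x0 f F : dseq x0 f -> (forall x, x0 < x -> F x = f 0 x) ->
  forall j x, x0 < x -> derivable (derive1n j F) x 1.
Proof.
move=> df Ff j x x0x.
have := eq_gt_is_derive x0x
  (fun y yx => esym (dseq_derive1n df Ff j yx)) (df j x x0x).
by case.
Qed.

Lemma dseq_nderivable x0 f F m p : dseq x0 f ->
  (forall x, x0 < x -> F x = f 0 x) -> x0 < p -> nderivable m F p.
Proof.
move=> df Ff x0p k _; apply: filterS (near_gt x0p) => q x0q.
exact: dseq_derivable df Ff _ _ x0q.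
Qed.

Lemma dseq_continuous x0 f j x : dseq x0 f -> x0 < x ->
  {for x, continuous (f j)}.
Proof.
move=> df x0x; apply/differentiable_continuous/derivable1_diffP.
by case: (df j x x0x).
Qed.

(** The derivatives of a product, arranged so that the Leibniz rule needs no
    binomial coefficients: everything about the [j]-th derivative of [c * u]
    follows by an induction in which [c] and [u] are replaced by their
    derivatives. *)
Fixpoint Leibniz (c u : nat -> R -> R) (j : nat) : R -> R :=
  match j with
  | 0 => fun x => c 0 x * u 0 x
  | j'.+1 => fun x => Leibniz (shift_seq c) u j' x + Leibniz c (shift_seq u) j' x
  end.

Lemma dseq_Leibniz x0 c u : dseq x0 c -> dseq x0 u -> dseq x0 (Leibniz c u).
Proof.
move=> dc du j x x0x; elim: j c u dc du => [|j ih] c u dc du /=.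
  exact: is_derive_mulr (dc 0 x x0x) (du 0 x x0x).
by apply: is_derive_addr; apply: ih => //; exact: dseq_shift.
Qed.

(** Unlike [dseq] this is stable under inverses with no formula for the
    derivatives; it serves to reach [1 / Gamma]. *)
Fixpoint diff_on x0 n (f : R -> R) : Prop :=
  if n is n'.+1 then
    exists2 f', (forall x, x0 < x -> is_derive x 1 f (f' x)) & diff_on x0 n' f'
  else True.

Lemma diff_on_ext x0 n (f g : R -> R) : (forall x, x0 < x -> f x = g x) ->
  diff_on x0 n f -> diff_on x0 n g.
Proof.
case: n => //= n fg [f' df dn]; exists f' => // x x0x.
exact: eq_gt_is_derive fg (df x x0x).
Qed.

Lemma diff_onW x0 n f : diff_on x0 n.+1 f -> diff_on x0 n f.
Proof.
elim: n f => // n ih f [f' df dn]; exists f' => //; exact: ih.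
Qed.

Lemma diff_on_add x0 n f g : diff_on x0 n f -> diff_on x0 n g ->
  diff_on x0 n (fun x => f x + g x).
Proof.
elim: n f g => //= n ih f g [f' df nf] [g' dg ng].
exists (fun x => f' x + g' x); last exact: ih.
by move=> x x0x; apply: is_derive_addr; [exact: df|exact: dg].
Qed.

Lemma diff_on_mul x0 n f g : diff_on x0 n f -> diff_on x0 n g ->
  diff_on x0 n (fun x => f x * g x).
Proof.
elim: n f g => // n ih f g nf ng.
have [f' df nf'] := nf; have [g' dg ng'] := ng.
exists (fun x => f' x * g x + f x * g' x).
  by move=> x x0x; apply: is_derive_mulr; [exact: df|exact: dg].
by apply: diff_on_add; apply: ih => //; exact: diff_onW.
Qed.

Lemma is_derive_inv (f : R -> R) x a : f x != 0 -> is_derive x 1 f a ->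
  is_derive x 1 (fun y => (f y)^-1) (- a * ((f x)^-1 * (f x)^-1)).
Proof.
move=> fx0 [df fa]; split; first exact: derivableV.
rewrite deriveV// fa /GRing.scale/= expr2 invfM.
by rewrite mulrC mulrN -mulNr.
Qed.

Lemma diff_on_inv x0 n f : (forall x, x0 < x -> f x != 0) ->
  diff_on x0 n f -> diff_on x0 n (fun x => (f x)^-1).
Proof.
move=> f0; elim: n => // n ih nf.
have [f' df nf'] := nf.
exists (fun x => -1 * f' x * ((f x)^-1 * (f x)^-1)).
  move=> x x0x; rewrite mulN1r; apply: is_derive_inv; [exact: f0|exact: df].
have {}ih := ih (diff_onW nf).
apply: diff_on_mul; last exact: diff_on_mul.
apply: diff_on_mul => //.
elim: n {f f0 nf df nf' ih f'} => // n ih.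
by elim: n.+1 (-1 : R) => // k ihk r; exists (fun=> 0) => // x _; exact: is_derive_cst.
Qed.

Lemma dseq_diff_on x0 f n j : dseq x0 f -> diff_on x0 n (f j).
Proof. by move=> df; elim: n j => // n ih j; exists (f j.+1) => // x; exact: df. Qed.

(** A derivative is unique, so the ones provided for each [n] are the iterated
    derivatives and fit together in one sequence. *)
Lemma diff_on_dseq x0 f : (forall n, diff_on x0 n f) ->
  dseq x0 (fun j => derive1n j f).
Proof.
move=> df.
have step g : (forall n, diff_on x0 n.+1 g) ->
    (forall x, x0 < x -> is_derive x 1 g (derive1 g x)) /\
    forall n, diff_on x0 n (derive1 g).
  move=> dg; split=> [x x0x|n].
    have [g' dg' _] := dg 0; rewrite derive1E.
    by apply: DeriveDef => //; case: (dg' x x0x).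
  have [g' dg' ng'] := dg n; apply: diff_on_ext ng' => x x0x.
  by rewrite derive1E; have [_ ->] := dg' x x0x.
have all j : forall n, diff_on x0 n (derive1n j f).
  elim: j => [|j ih] //; rewrite derive1nS; apply: (step _ _).2 => n; exact: ih.
by move=> j x x0x; rewrite derive1nS; apply: (step _ _).1 => // n; exact: all.
Qed.

End derivative_sequences.

(** * Improper integrals of derivatives *)

Section FTC_exhaustion.
Context {R : realType}.
Notation mu := (@lebesgue_measure R).
Variables (I : set R) (a b : nat -> R) (F f : R -> R) (la lb : R).
Hypotheses (ab : forall n, a n < b n)
  (nia : forall m n, (m <= n)%N -> a n <= a m)
  (ndb : forall m n, (m <= n)%N -> b m <= b n)
  (IE : I = \bigcup_n [set` `[a n, b n]])
  (dF : forall x, I x -> is_derive x 1 F (f x))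
  (cf : forall x, I x -> {for x, continuous f})
  (Fa : F (a n) @[n --> \oo] --> la) (Fb : F (b n) @[n --> \oo] --> lb).

Let subI n : [set` `[a n, b n]] `<=` I.
Proof. by move=> x xab; rewrite IE; exists n. Qed.

Let contF x : I x -> {for x, continuous F}.
Proof.
move=> Ix; apply/differentiable_continuous/derivable1_diffP.
by case: (dF Ix).
Qed.

Let cfn n : {within [set` `[a n, b n]], continuous f}.
Proof.
by apply: continuous_in_subspaceT => x /set_mem xab; apply: cf; exact: subI xab.
Qed.

Let mf n : measurable_fun [set` `[a n, b n]] f.
Proof. exact: measurable_realfun.subspace_continuous_measurable_fun. Qed.

Lemma FTC_exhaustion_measurable : measurable_fun I f.
Proof. by rewrite IE; apply/measurable_fun_bigcup. Qed.

Let mI : measurable I.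
Proof. by rewrite IE; apply: bigcupT_measurable. Qed.

Let FTCn n : (\int[mu]_(x in `[a n, b n]) (f x)%:E = (F (b n) - F (a n))%:E)%E.
Proof.
have abn := ab n.
have Ia : I (a n) by apply: (@subI n); rewrite /= in_itv/= lexx ltW.
have Ib : I (b n) by apply: (@subI n); rewrite /= in_itv/= lexx ltW.
rewrite (@continuous_FTC2 _ f F) ?EFinB//.
- split.
  + move=> x xab; have /dF[] // : I x.
    by apply: (@subI n); exact: subset_itv_oo_cc xab.
  + by apply: cvg_at_right_filter; exact: contF.
  + by apply: cvg_at_left_filter; exact: contF.
- move=> x xab; have Ix : I x by apply: (@subI n); exact: subset_itv_oo_cc xab.
  by rewrite derive1E; have [_ ->] := dF Ix.
Qed.

Let ndI : {homo (fun n => [set` `[a n, b n]]) : n m / (n <= m)%N >-> (n <= m)%O}.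
Proof.
move=> m n mn; apply/subsetPset => x /=; rewrite !in_itv/= => /andP[h1 h2].
by rewrite (le_trans (nia mn))//= (le_trans h2)//; exact: ndb.
Qed.

Let cvgFTC : (F (b n) - F (a n))%:E @[n --> \oo] --> (lb - la)%:E.
Proof. by apply: cvg_EFin; [exact: nearW|exact: cvgB]. Qed.

(** Monotone convergence along the segments [a n, b n]; finiteness of the
    integral is a conclusion, which is how integrability is obtained below. *)
Lemma ge0_FTC_exhaustion : (forall x, I x -> 0 <= f x) ->
  (\int[mu]_(x in I) (f x)%:E = (lb - la)%:E)%E.
Proof.
move=> f0; have := @ge0_nondecreasing_set_cvg_integral _ (measurableTypeR R) R
  _ (EFin \o f) mu ndI (fun=> measurable_itv _)
  (fun n => (measurable_EFinP _ _).2 (@mf n)) (fun n x xn => f0 _ (@subI n x xn)).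
rewrite -IE; under eq_cvg do rewrite FTCn.
by move=> h; exact: (cvg_unique _ h cvgFTC).
Qed.

(** Dominated convergence along the segments [a n, b n]. *)
Lemma FTC_exhaustion : mu.-integrable I (EFin \o f) ->
  \int[mu]_(x in I) f x = lb - la.
Proof.
move=> intf.
have IIn n : [set` `[a n, b n]] = I `&` [set` `[a n, b n]].
  by apply/esym/setIidPr; exact: subI.
pose fn n := EFin \o (f \_ [set` `[a n, b n]]).
have [|||||_ _] := @dominated_convergence _ _ _ mu I mI fn (EFin \o f)
    (abse \o (EFin \o f)).
- move=> n; apply/measurable_EFinP; apply/measurable_restrict => //.
  by rewrite -IIn; exact: mf.
- by apply/measurable_EFinP; exact: FTC_exhaustion_measurable.
- apply: aeW => x; rewrite IE => -[n _ xn].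
  apply: (@cvg_near_cst _ _ _ _ _); exists n => //= m /= nm.
  rewrite /fn/= patchE mem_set//.
  by have /subsetPset := ndI nm; apply.
- exact: integrable_abse.
- apply: aeW => x n Ix; rewrite /fn/= lee_fin patchE.
  by case: ifPn => // _; rewrite normr0.
under eq_cvg.
  move=> n; rewrite /= /fn -restrict_EFin -integral_mkcondr -IIn FTCn.
  over.
by move=> h; rewrite /Rintegral (cvg_unique _ h cvgFTC).
Qed.

End FTC_exhaustion.

Section FTC_intervals.
Context {R : realType}.
Notation mu := (@lebesgue_measure R).
Implicit Types F f : R -> R.

Let ndh (m n : nat) : (m <= n)%N -> (harmonic n : R) <= harmonic m.
Proof. by move=> mn; rewrite /harmonic/= lef_pV2 ?posrE// ler_nat ltnS. Qed.

Let h1 n : (harmonic n : R) <= 1.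
Proof. by rewrite /harmonic/= invf_le1// ler1n. Qed.

Variables (a b : R) (F f : R -> R) (la lb : R).
Hypothesis ab : a < b.
Hypothesis dF : forall x, a < x < b -> is_derive x 1 F (f x).
Hypothesis cf : forall x, a < x < b -> {for x, continuous f}.
Hypothesis Fa : F x @[x --> a^'+] --> la.
Hypothesis Fb : F x @[x --> b^'-] --> lb.

Let an n := a + (b - a) / 3 * harmonic n.
Let bn n := b - (b - a) / 3 * harmonic n.

Let d0 : 0 < (b - a) / 3. Proof. by rewrite divr_gt0// subr_gt0. Qed.

Let cvgh (c : R) : c * harmonic n @[n --> \oo] --> (0 : R).
Proof. by rewrite -(mulr0 c); apply: cvgMr; exact: cvg_harmonic. Qed.

Let abn n : an n < bn n.
Proof.
rewrite /an /bn; have := h1 n; have := harmonic_gt0 n : (0 : R) < _.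
move: (harmonic n) => h hp hl; have d00 := d0.
have : (b - a) / 3 * h <= (b - a) / 3 by rewrite ler_piMr// ltW.
move: ab d00; lra.
Qed.

Let nia m n : (m <= n)%N -> an n <= an m.
Proof. by move=> /ndh; rewrite /an lerD2l ler_pM2l. Qed.

Let ndb m n : (m <= n)%N -> bn m <= bn n.
Proof. by move=> /ndh; rewrite /bn lerD2l lerN2 ler_pM2l. Qed.

Let IE : [set` `]a, b[] = \bigcup_n [set` `[an n, bn n]].
Proof.
apply/seteqP; split => x /=; rewrite in_itv/=.
- move=> /andP[ax xb].
  have [n _ hn] : \forall n \near \oo,
      (b - a) / 3 * harmonic n < x - a /\ (b - a) / 3 * harmonic n < b - x.
    near=> n; split; near: n; apply: cvgr_lt; [exact: cvgh|by rewrite subr_gt0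
      |exact: cvgh|by rewrite subr_gt0].
  exists n => //=; rewrite in_itv/= /an /bn.
  have [] := hn n (leqnn n); lra.
- move=> [n _] /=; rewrite in_itv/= /an /bn => /andP[h2 h3].
  have := mulr_gt0 d0 (harmonic_gt0 n : (0 : R) < _); lra.
Unshelve. all: by end_near. Qed.

Let Fan : F (an n) @[n --> \oo] --> la.
Proof.
move/cvg_at_rightP : Fa; apply; split.
  by move=> n; rewrite /an ltrDl mulr_gt0// harmonic_gt0.
by rewrite -[X in _ --> X]addr0; apply: cvgD; [exact: cvg_cst|exact: cvgh].
Qed.

Let Fbn : F (bn n) @[n --> \oo] --> lb.
Proof.
move/cvg_at_leftP : Fb; apply; split.
  by move=> n; rewrite /bn gtrBl mulr_gt0// harmonic_gt0.
by rewrite -[X in _ --> X]subr0; apply: cvgB; [exact: cvg_cst|exact: cvgh].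
Qed.

Lemma itvoo_FTC_measurable : measurable_fun `]a, b[ f.
Proof. by apply: FTC_exhaustion_measurable IE _ => x; rewrite /= in_itv; exact: cf. Qed.

Lemma ge0_itvoo_FTC : (forall x, a < x < b -> 0 <= f x) ->
  (\int[mu]_(x in `]a, b[) (f x)%:E = (lb - la)%:E)%E.
Proof.
move=> f0; apply: (@ge0_FTC_exhaustion R _ an bn F f la lb) => //.
Qed.

Lemma ge0_itvoo_integrable : (forall x, a < x < b -> 0 <= f x) ->
  mu.-integrable `]a, b[ (EFin \o f).
Proof.
move=> f0; apply/integrableP; split.
  by apply/measurable_EFinP; exact: itvoo_FTC_measurable.
rewrite (_ : integral _ _ _ = (lb - la)%:E) ?ltry// -(ge0_itvoo_FTC f0).
apply: eq_integral => x; rewrite inE /= in_itv/= => /f0 fx.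
by rewrite ger0_norm.
Qed.

Lemma itvoo_FTC : mu.-integrable `]a, b[ (EFin \o f) ->
  \int[mu]_(x in `]a, b[) f x = lb - la.
Proof.
exact: (@FTC_exhaustion R _ an bn F f la lb).
Qed.

End FTC_intervals.

Section FTC_halfline.
Context {R : realType}.
Notation mu := (@lebesgue_measure R).
Variables (F f : R -> R) (la lb : R).
Hypothesis dF : forall x : R, 0 < x -> is_derive x 1 F (f x).
Hypothesis cf : forall x : R, 0 < x -> {for x, continuous f}.
Hypothesis Fa : F x @[x --> 0^'+] --> la.
Hypothesis Fb : F x @[x --> +oo] --> lb.

Let an n : R := harmonic n.
Let bn n : R := n.+2%:R.

Let abn n : an n < bn n.
Proof.
rewrite /an /bn /harmonic/= (@le_lt_trans _ _ 1)// ?invf_le1// ?ler1n//.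
by rewrite ltr1n.
Qed.

Let nia m n : (m <= n)%N -> an n <= an m.
Proof. by move=> mn; rewrite /an /harmonic/= lef_pV2 ?posrE// ler_nat ltnS. Qed.

Let ndb m n : (m <= n)%N -> bn m <= bn n.
Proof. by move=> mn; rewrite ler_nat !ltnS. Qed.

Let cvgbn : bn n @[n --> \oo] --> +oo.
Proof.
apply/cvgryPge => A; near=> n; rewrite (@le_trans _ _ n%:R)//.
  by near: n; exact: nbhs_infty_ger.
by rewrite ler_nat (leq_trans (leqnSn _)).
Unshelve. all: by end_near. Qed.

Let IE : [set` `]0, +oo[] = \bigcup_n [set` `[an n, bn n]].
Proof.
apply/seteqP; split => x /=; rewrite in_itv/= ?andbT.
- move=> x0.
  have [n _ hn] : \forall n \near \oo, an n < x /\ x <= bn n.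
    near=> n; split; near: n.
      by apply: cvgr_lt x0; exact: cvg_harmonic.
    by move/cvgryPge : cvgbn; exact.
  exists n => //=; rewrite in_itv/=.
  by have [/ltW -> ->] := hn n (leqnn n).
- move=> [n _] /=; rewrite in_itv/= => /andP[h2 h3].
  by rewrite (lt_le_trans _ h2)// harmonic_gt0.
Unshelve. all: by end_near. Qed.

Let Fan : F (an n) @[n --> \oo] --> la.
Proof.
move/cvg_at_rightP : Fa; apply; split; last exact: cvg_harmonic.
by move=> n; exact: harmonic_gt0.
Qed.

Let Fbn : F (bn n) @[n --> \oo] --> lb.
Proof. by move/cvg_pinftyP : Fb; apply. Qed.

Lemma halfline_FTC : mu.-integrable `]0, +oo[ (EFin \o f) ->
  \int[mu]_(x in `]0, +oo[) f x = lb - la.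
Proof.
move=> intf; apply: (@FTC_exhaustion R _ an bn F f la lb) => // x;
  rewrite /= in_itv/= andbT; [exact: dF|exact: cf].
Qed.

Lemma ge0_halfline_FTC : (forall x, 0 < x -> 0 <= f x) ->
  (\int[mu]_(x in [set` `]0%R, +oo[%R]) (f x)%:E = (lb - la)%:E)%E.
Proof.
move=> f0; apply: (@ge0_FTC_exhaustion R _ an bn F f la lb) => // x;
  rewrite /= in_itv/= andbT; [exact: dF|exact: cf|exact: f0].
Qed.

End FTC_halfline.

(** * Integrability and domination on the half-line *)

Section real_integrability.
Context d (T : measurableType d) {R : realType} (nu : {measure set T -> \bar R}).
Implicit Types (D : set T) (f g : T -> R).

Lemma dominated_integrableR D f g : measurable D -> measurable_fun D f ->
  nu.-integrable D (EFin \o g) -> (forall x, D x -> `|f x| <= g x) ->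
  nu.-integrable D (EFin \o f).
Proof.
move=> mD mf ig fg; apply: le_integrable ig => //.
  by apply/measurable_EFinP.
by move=> x Dx; rewrite /= lee_fin (le_trans (fg _ Dx))// ler_norm.
Qed.

Lemma integrableRD D f g : measurable D -> nu.-integrable D (EFin \o f) ->
  nu.-integrable D (EFin \o g) -> nu.-integrable D (EFin \o (fun x => f x + g x)).
Proof.
move=> mD i1 i2; rewrite (_ : EFin \o _ = ((EFin \o f) \+ (EFin \o g))%E).
  exact: integrableD.
by apply/funext => x /=; rewrite EFinD.
Qed.

Lemma integrableRZ D c f : measurable D -> nu.-integrable D (EFin \o f) ->
  nu.-integrable D (EFin \o (fun x => c * f x)).
Proof.
move=> mD i1; rewrite (_ : EFin \o _ = (fun x => c%:E * (f x)%:E)%E).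
  exact: integrableZl.
by apply/funext => x /=; rewrite EFinM.
Qed.

Lemma eq_integrableR D f g : measurable D -> (forall x, D x -> f x = g x) ->
  nu.-integrable D (EFin \o f) -> nu.-integrable D (EFin \o g).
Proof.
by move=> mD fg; apply: eq_integrable => // x /set_mem Dx; rewrite /= fg.
Qed.

End real_integrability.

Section domination.
Context {R : realType}.
Notation mu := (@lebesgue_measure R).
Implicit Types (e x : R) (k : nat).

Lemma is_derive_under_integral d (Y : measurableType d)
    (nu : {measure set Y -> \bar R}) (B : set Y) (f f' : R -> Y -> R)
    (G : Y -> R) (a u v : R) : measurable B -> u < a < v ->
  (forall x, u < x < v -> nu.-integrable B (EFin \o f x)) ->
  (forall x y, u < x < v -> B y -> is_derive x 1 (f ^~ y : R -> R) (f' x y)) ->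
  nu.-integrable B (EFin \o G) ->
  (forall x y, u < x < v -> B y -> `|f' x y| <= G y) ->
  is_derive a 1 (fun x => \int[nu]_(y in B) f x y) (\int[nu]_(y in B) f' a y).
Proof.
move=> mB uav intf df intG fG.
have Ia : [set` `]u, v[] a by rewrite /= in_itv/=.
have df1 x y : [set` `]u, v[] x -> B y -> derivable (f ^~ y : R -> R) x 1.
  by rewrite /= in_itv/= => xuv By; case: (df x y xuv By).
have df2 x y : [set` `]u, v[] x -> B y -> partial1of2 f x y = f' x y.
  rewrite /= in_itv/= => xuv By; rewrite partial1of2E.
  by case: (df x y xuv By).
have intf1 x : [set` `]u, v[] x -> nu.-integrable B (EFin \o f x).
  by rewrite /= in_itv/=; exact: intf.
have intG' : nu.-integrable B (EFin \o (fun y => `|G y|)).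
  exact: (integrable_abse intG).
have fG' x y : [set` `]u, v[] x -> B y -> `|partial1of2 f x y| <= `|G y|.
  move=> xuv By; rewrite (df2 _ _ xuv By) (le_trans _ (ler_norm _))// fG//.
apply: DeriveDef; first exact: (derivable_under_integral mB Ia intf1 df1
  (fun y => normr_ge0 _) intG' fG').
rewrite -derive1E (differentiation_under_integral mB Ia intf1 df1
  (fun y => normr_ge0 _) intG' fG').
by apply: eq_Rintegral => y /set_mem By; exact: df2.
Qed.

Lemma expr_le_expR k e : 0 < e ->
  exists2 K, 0 < K & forall y, 0 <= y -> y ^+ k <= K * expR (e * y).
Proof.
move=> e0.
(* with z = e y / (k + 1): y ^ k = K z ^ k, exp (e y) = (exp z) ^ (k + 1) *)
exists ((k.+1%:R / e) ^+ k).
  by rewrite exprn_gt0// divr_gt0.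
move=> y y0; have k0 : (0 : R) < k.+1%:R by [].
have -> : expR (e * y) = expR (e * y / k.+1%:R) ^+ k.+1.
  by rewrite -expRM_natl (mulrC _ (_ / _)) mulfVK ?gt_eqF.
set z := e * y / k.+1%:R.
have z0 : 0 <= z by rewrite /z !mulr_ge0// ltW// invr_gt0.
have -> : y ^+ k = (k.+1%:R / e) ^+ k * z ^+ k.
  rewrite -exprMn; congr (_ ^+ _); rewrite /z.
  by field; rewrite !gt_eqF.
rewrite ler_pM2l ?exprn_gt0 ?divr_gt0//.
have z1 : z <= expR z by rewrite (le_trans _ (expR_ge1Dx _))// lerDr.
have z2 : 1 <= expR z by rewrite (le_trans _ (expR_ge1Dx _))// lerDl.
rewrite exprS (@le_trans _ _ (expR z ^+ k))//.
  by apply: lerXn2r; rewrite ?nnegrE ?expR_ge0.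
by rewrite ler_peMl// exprn_ge0// expR_ge0.
Qed.

Lemma powR_le_expR a e : 0 < a ->
  exists2 K, 0 < K & forall x, 1 <= x -> x `^ e <= K * expR (a * x).
Proof.
move=> a0; have [K K0 HK] := expr_le_expR (Num.Def.truncn `|e|).+1 a0.
exists K => // x x1; have x0 : 0 <= x := le_trans ler01 x1.
apply: le_trans (HK _ x0).
rewrite -powR_mulrn//; apply: ler_powR => //.
by rewrite (le_trans (ler_norm _))// ltW// truncnS_gt.
Qed.

Lemma ln_le_powR k e : 0 < e -> exists2 K, 0 < K &
  forall x, 0 < x -> `|ln x| ^+ k <= K * (x `^ e + x `^ (- e)).
Proof.
move=> e0; have [K K0 HK] := expr_le_expR k e0.
exists K => // x x0; apply: le_trans (HK _ (normr_ge0 _)) _.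
rewrite ler_pM2l//.
rewrite /powR gt_eqF//; have [l0|l0] := leP 0 (ln x).
  by rewrite ger0_norm// lerDl expR_ge0.
by rewrite ltr0_norm// mulrN mulNr lerDr expR_ge0.
Qed.

Lemma continuous_powRl e x : 0 < x -> {for x, continuous (@powR R ^~ e)}.
Proof.
move=> x0; apply/differentiable_continuous/derivable1_diffP.
by have [] := is_derive1_powR e x0.
Qed.

(** The integrand is nonnegative and its primitive has a limit at [0]. *)
Lemma integrable_powR_left e (b : R) : 0 < e -> 0 < b ->
  mu.-integrable `]0, b[ (EFin \o (@powR R ^~ (e - 1))).
Proof.
move=> e0 b0.
apply: (@ge0_itvoo_integrable _ _ _ (fun x => e^-1 * x `^ e) _ 0 (e^-1 * b `^ e)) => //.
- move=> x /andP[x0 _].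
  have := is_deriveZ e^-1 (is_derive1_powR e x0).
  rewrite /GRing.scale/= => h; apply: is_derive_eq.
  by rewrite mulrA mulVf ?mul1r// gt_eqF.
- by move=> x /andP[x0 _]; exact: continuous_powRl.
- rewrite -[X in _ --> X](mulr0 e^-1); apply: cvgMr; exact: powR_cvg0.
- by apply: cvg_at_left_filter; apply: cvgMr; exact: continuous_powRl.
- by move=> x _; exact: powR_ge0.
Qed.

Lemma cvgy_expRN (a : R) : 0 < a -> expR (- (a * x)) @[x --> +oo] --> (0 : R).
Proof.
move=> a0; rewrite (_ : (fun x => _) = (fun z => expR (- z)) \o (fun z => a * z))//.
apply: (@cvg_comp _ _ _ _ _ _ (pinfty_nbhs R)); last exact: cvgr_expR.
exact: gt0_cvgMry.
Qed.

Lemma is_derive_expRN (a x : R) :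
  is_derive x 1 (fun y => expR (- (a * y))) (- a * expR (- (a * x))).
Proof.
have h : is_derive x 1 (fun y => - (a * y)) (- a).
  have := is_deriveN (is_deriveZ a (is_derive_id x 1)).
  by rewrite /GRing.scale/= mulr1.
have := is_derive1_comp (is_derive_expR _) h.
by rewrite /comp => h'; apply: is_derive_eq; rewrite mulrC.
Qed.

Lemma continuous_expRN (a x : R) : {for x, continuous (fun y => expR (- (a * y)))}.
Proof.
apply/differentiable_continuous/derivable1_diffP.
by have [] := is_derive_expRN a x.
Qed.

Lemma integral_expRN (a : R) : 0 < a ->
  (\int[mu]_(x in [set` `]0%R, +oo[%R]) (a * expR (- (a * x)))%:E = 1)%E.
Proof.
move=> a0.
rewrite [RHS](_ : _ = (0 - (-1))%:E)%E; last by rewrite sub0r opprK.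
apply: (@ge0_halfline_FTC _ (fun x => - expR (- (a * x)))) => //.
- move=> x x0; have := is_deriveN (is_derive_expRN a x) => h.
  by apply: is_derive_eq; rewrite mulNr opprK.
- move=> x x0; apply: cvgMr; exact: continuous_expRN.
- rewrite [X in _ --> X](_ : _ = - expR (- (a * 0))); last by rewrite mulr0 oppr0 expR0.
  apply: cvgN;  apply: cvg_at_right_filter; exact: continuous_expRN.
- by rewrite -oppr0; apply: cvgN; exact: cvgy_expRN.
- by move=> x x0; rewrite mulr_ge0 ?expR_ge0// ltW.
Qed.

Lemma integrable_expRN (a : R) : 0 < a ->
  mu.-integrable [set` `]0, +oo[] (EFin \o (fun x => expR (- (a * x)))).
Proof.
move=> a0.
have i1 : mu.-integrable [set` `]0, +oo[] (EFin \o (fun x => a * expR (- (a * x)))).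
  apply/integrableP; split.
    apply/measurable_EFinP; apply: measurable_funTS; apply: continuous_measurable_fun.
    by move=> x; apply: cvgMr; exact: continuous_expRN.
  rewrite (_ : integral _ _ _ = 1%E) ?ltry// -(integral_expRN a0).
  apply: eq_integral => x _ /=.
  by rewrite ger0_norm// mulr_ge0 ?expR_ge0// ltW.
apply: eq_integrableR (integrableRZ a^-1 _ i1) => // x _.
by rewrite mulrA mulVf ?mul1r// gt_eqF.
Qed.

Lemma integrable_gamma e (a : R) : 0 < e -> 0 < a ->
  mu.-integrable [set` `]0, +oo[] (EFin \o (fun x => x `^ (e - 1) * expR (- (a * x)))).
Proof.
move=> e0 a0; have a20 : 0 < a / 2 by rewrite divr_gt0.
have [K K0 HK] := powR_le_expR (e - 1) a20.
pose g1 := (@powR R ^~ (e - 1)) \_ `]0, 1[.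
pose g2 x := K * expR (- (a / 2 * x)).
have i1 : mu.-integrable [set` `]0, +oo[] (EFin \o g1).
  rewrite -restrict_EFin; apply/integrable_restrict => //.
  rewrite (_ : _ `&` _ = [set` `]0, 1[]); first exact: integrable_powR_left.
  by apply/setIidPr => x /=; rewrite !in_itv/= => /andP[-> _].
have i2 : mu.-integrable [set` `]0, +oo[] (EFin \o g2).
  by apply: integrableRZ => //; exact: integrable_expRN.
apply: (dominated_integrableR _ _ (integrableRD _ i1 i2)) => //.
- apply: measurable_funM.
    by apply: measurable_funTS; exact: measurable_powR.
  apply: measurable_funTS; apply: continuous_measurable_fun => x.
  exact: continuous_expRN.
- move=> x; rewrite /= in_itv/= andbT => x0.
  have g10 : 0 <= g1 x by rewrite /g1 patchE; case: ifP => // _; exact: powR_ge0.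
  have g20 : 0 <= g2 x by rewrite /g2 mulr_ge0 ?expR_ge0// ltW.
  rewrite ger0_norm ?mulr_ge0 ?powR_ge0 ?expR_ge0//.
  have [x1|x1] := ltP x 1.
    rewrite ler_wpDr// /g1 patchE mem_set/= ?in_itv/= ?x0 ?x1//.
    by rewrite ler_piMr ?powR_ge0// -expR0 ler_expR oppr_le0 mulr_ge0// ltW.
  rewrite ler_wpDl// /g2.
  have -> : - (a * x) = - (a / 2 * x) + - (a / 2 * x) by field.
  rewrite expRD mulrA ler_pM2r ?expR_gt0//.
  by rewrite expRN ler_pdivrMr ?expR_gt0// HK.
Qed.

Lemma measurable_expRN (a : R) (D : set R) :
  measurable_fun D (fun x => expR (- (a * x))).
Proof.
apply: measurable_funTS; apply: continuous_measurable_fun => x.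
exact: continuous_expRN.
Qed.

Lemma measurable_lnX k (D : set R) : measurable_fun D (fun x : R => ln x ^+ k).
Proof. by apply: measurable_funX; apply: measurable_funTS; exact: measurable_ln. Qed.

(** Two powers, because a shape parameter that varies between [e1] and [e2] is
    controlled by [e1] for small [x] and by [e2] for large [x]. *)
Definition envelope (a : R) k e1 e2 x :=
  `|ln x| ^+ k * (x `^ (e1 - 1) + x `^ (e2 - 1)) * expR (- (a * x)).

(** A power of the logarithm costs an arbitrarily small power of [x] at [0] and
    at infinity. *)
Lemma integrable_ln_gamma k e (a : R) : 0 < e -> 0 < a ->
  mu.-integrable [set` `]0, +oo[]
    (EFin \o (fun x => `|ln x| ^+ k * (x `^ (e - 1) * expR (- (a * x))))).
Proof.
move=> e0 a0; have e20 : 0 < e / 2 by rewrite divr_gt0.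
have [K K0 HK] := ln_le_powR k e20.
pose g d x := x `^ (d - 1) * expR (- (a * x)).
have ig d : 0 < d -> mu.-integrable [set` `]0, +oo[] (EFin \o g d).
  by move=> d0; exact: integrable_gamma.
have i1 : 0 < e + e / 2 by rewrite addr_gt0.
apply: (dominated_integrableR _ _ (integrableRZ K _ (integrableRD _ (ig _ i1) (ig _ e20)))) => //.
- apply: measurable_funM.
    apply: measurable_funX; apply: measurableT_comp => //.
    by apply: measurable_funTS; exact: measurable_ln.
  apply: measurable_funM; last exact: measurable_expRN.
  by apply: measurable_funTS; exact: measurable_powR.
- move=> x; rewrite /= in_itv/= andbT => x0.
  rewrite (ger0_norm (mulr_ge0 _ _)) ?mulr_ge0 ?exprn_ge0 ?powR_ge0 ?expR_ge0//.
  have -> : g (e + e / 2) x + g (e / 2) x =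
      (x `^ (e / 2) + x `^ (- (e / 2))) * (x `^ (e - 1) * expR (- (a * x))).
    rewrite /g mulrA mulrDl -!powRD ?(gt_eqF x0) ?implybT// mulrDl.
    by congr (_ `^ _ * _ + _ `^ _ * _); field.
  rewrite mulrA ler_wpM2r ?mulr_ge0 ?powR_ge0 ?expR_ge0//.
  exact: HK.
Qed.

Lemma integrable_envelope a k e1 e2 : 0 < a -> 0 < e1 -> 0 < e2 ->
  mu.-integrable [set` `]0, +oo[] (EFin \o envelope a k e1 e2).
Proof.
move=> a0 e10 e20.
apply: eq_integrableR (integrableRD _ (integrable_ln_gamma k e10 a0)
  (integrable_ln_gamma k e20 a0)) => // x _.
by rewrite /envelope -mulrA mulrDl mulrDr.
Qed.

Lemma powR_between x s s1 s2 : 0 < x -> s1 <= s <= s2 ->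
  x `^ s <= x `^ s1 + x `^ s2.
Proof.
move=> x0 /andP[s1s ss2]; have [x1|x1] := leP x 1.
  by rewrite ler_wpDr ?powR_ge0// ger_powR// x0 x1.
by rewrite ler_wpDl ?powR_ge0// ler_powR// ltW.
Qed.

End domination.

(** * Mellin transforms and the Gamma function *)

Lemma is_derive_mulrl {R : realType} (c x : R) : is_derive x 1 (fun y => y * c) c.
Proof.
have := is_derive_mulr (is_derive_id x 1) (is_derive_cst c x 1).
by rewrite mulr0 addr0 mul1r.
Qed.

Section Mellin.
Context {R : realType}.
Notation mu := (@lebesgue_measure R).
Notation posR := [set` (`]0, +oo[ : interval R)].
Implicit Types (k : nat).

(** The [k]-th derivative in [s] of [l `^ (s - 1) * expR (- (a * l))]. *)
Definition gamma_kernel (a l : R) k (s : R) : R :=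
  ln l ^+ k * l `^ (s - 1) * expR (- (a * l)).

(** The [k]-th derivative at [s] of the Mellin transform of
    [h l * expR (- (a * l))]. *)
Definition Mellin (a : R) (h : R -> R) k (s : R) : R :=
  \int[mu]_(l in `]0, +oo[) (h l * gamma_kernel a l k s).

Lemma dseq_gamma_kernel (a l z : R) : 0 < l -> dseq z (gamma_kernel a l).
Proof.
move=> l0 j x _.
have d1 : is_derive x 1 (fun s : R => (s - 1) * ln l) (ln l).
  have := is_deriveZ (ln l) (is_deriveB (is_derive_id x 1) (is_derive_cst (1 : R) x 1)).
  rewrite /GRing.scale/= subr0 mulr1 => h.
  by rewrite (_ : (fun s : R => _) = (fun y => ln l * (y - 1)))//; apply/funext => s;
    rewrite mulrC.
have d2 : is_derive x 1 (fun s : R => expR ((s - 1) * ln l)) (expR ((x - 1) * ln l) * ln l).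
  exact: is_derive1_comp.
rewrite (_ : gamma_kernel a l j =
    (fun s => (ln l ^+ j * expR (- (a * l))) * expR ((s - 1) * ln l))); last first.
  by apply/funext => s; rewrite /gamma_kernel /powR gt_eqF// mulrAC.
have := is_deriveZ (ln l ^+ j * expR (- (a * l))) d2.
rewrite /GRing.scale/= => h; apply: is_derive_eq.
by rewrite /gamma_kernel /powR gt_eqF// exprS; ring.
Qed.

Variables (a b C : R) (h : R -> R).
Hypotheses (a0 : 0 < a) (C0 : 0 <= C)
  (mh : measurable_fun posR h)
  (hC : forall l, 0 < l -> `|h l| <= C * l `^ b).

Lemma Mellin_dominated l k s s1 s2 : 0 < l -> s1 <= s <= s2 ->
  `|h l * gamma_kernel a l k s| <= C * envelope a k (b + s1) (b + s2) l.
Proof.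
move=> l0 ss; rewrite normrM /gamma_kernel !normrM normrX.
rewrite (ger0_norm (powR_ge0 _ _)) (ger0_norm (expR_ge0 _)).
apply: (@le_trans _ _ (C * l `^ b * (`|ln l| ^+ k * l `^ (s - 1) * expR (- (a * l))))).
  apply: ler_wpM2r; last exact: hC.
  by rewrite !mulr_ge0 ?exprn_ge0 ?powR_ge0 ?expR_ge0.
rewrite -mulrA ler_wpM2l// /envelope.
have -> : l `^ b * (`|ln l| ^+ k * l `^ (s - 1) * expR (- (a * l))) =
    `|ln l| ^+ k * l `^ (b + s - 1) * expR (- (a * l)).
  by rewrite -addrA (@powRD _ l b) ?(gt_eqF l0) ?implybT//; ring.
rewrite ler_wpM2r ?expR_ge0// ler_wpM2l ?exprn_ge0// powR_between//.
by have /andP[h1 h2] := ss; rewrite !lerD2r !lerD2l h1.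
Qed.

Lemma measurable_gamma_kernel k s :
  measurable_fun posR (fun l => gamma_kernel a l k s).
Proof.
apply: measurable_funM; last exact: measurable_expRN.
apply: measurable_funM; first exact: measurable_lnX.
by apply: measurable_funTS; exact: measurable_powR.
Qed.

Lemma measurable_Mellin_integrand k s :
  measurable_fun posR (fun l => h l * gamma_kernel a l k s).
Proof. by apply: measurable_funM => //; exact: measurable_gamma_kernel. Qed.

Lemma integrable_Mellin k s : - b < s ->
  mu.-integrable posR (EFin \o (fun l => h l * gamma_kernel a l k s)).
Proof.
move=> bs; have s0 : 0 < b + s by rewrite -ltrBlDl sub0r.
apply: (dominated_integrableR _ _
  (integrableRZ C _ (integrable_envelope k a0 s0 s0))) => //.
  exact: measurable_Mellin_integrand.
move=> l; rewrite /= in_itv/= andbT => l0; apply: Mellin_dominated => //.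
by rewrite lexx.
Qed.

(** A bound of [h] by [l `^ b] at the origin extends the Mellin transform to the
    left of [0], down to [- b]. *)
Lemma dseq_Mellin : dseq (- b) (Mellin a h).
Proof.
move=> k s bs; pose d := (s + b) / 2.
have d0 : 0 < d by rewrite divr_gt0// -ltrBlDr sub0r.
have e1 : 0 < b + (s - d).
  by rewrite (_ : _ + _ = d)// /d; field.
have e2 : 0 < b + (s + d) by rewrite (lt_le_trans e1)// lerD2l lerD2l ge0_cp// ltW.
apply: (@is_derive_under_integral _ _ _ mu _
  (fun s l => h l * gamma_kernel a l k s) (fun s l => h l * gamma_kernel a l k.+1 s)
  _ _ (s - d) (s + d) _ _ _ _ (integrableRZ C _ (integrable_envelope k.+1 a0 e1 e2))) => //.
- by rewrite ltrBlDr ltrDl d0.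
- move=> x /andP[x1 _]; apply: integrable_Mellin; rewrite (lt_trans _ x1)//.
  by rewrite -subr_gt0 opprK addrC.
- move=> x l _; rewrite /= in_itv/= andbT => l0.
  have x1 : x - 1 < x by rewrite ltrBlDr ltrDl.
  exact: (is_deriveZ (h l) (@dseq_gamma_kernel a l (x - 1) l0 k x x1)).
- move=> x l /andP[x1 x2]; rewrite /= in_itv/= andbT => l0.
  by apply: Mellin_dominated; rewrite // !ltW.
Qed.

End Mellin.

Section Gamma.
Context {R : realType}.
Notation mu := (@lebesgue_measure R).
Notation posR := [set` (`]0, +oo[ : interval R)].

Let one_le (l : R) : 0 < l -> `|cst (1 : R) l| <= 1 * l `^ 0.
Proof. by move=> _; rewrite powRr0 mulr1 normr1. Qed.

Let m1 : measurable_fun posR (cst (1 : R)).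
Proof. exact: measurable_cst. Qed.

Lemma Gamma_funE (x : R) : Gamma_fun x = Mellin 1 (cst 1) 0 x.
Proof.
apply: eq_Rintegral => l _; rewrite /gamma_kernel expr0 !mul1r.
by [].
Qed.

Lemma dseq_Gamma : dseq 0 (Mellin 1 (cst (1 : R))).
Proof. by rewrite -oppr0; exact: dseq_Mellin ltr01 ler01 m1 one_le. Qed.

Lemma integrable_Gamma (x : R) : 0 < x ->
  mu.-integrable posR (EFin \o (fun y => y `^ (x - 1) * expR (- y))).
Proof.
move=> x0; apply: eq_integrableR (integrable_gamma x0 ltr01) => // y _.
by rewrite mul1r.
Qed.

Lemma Gamma_fun1 : Gamma_fun (1 : R) = 1.
Proof.
rewrite /Gamma_fun /Rintegral -[RHS]/(fine 1%E) -(integral_expRN ltr01).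
by congr fine; apply: eq_integral => y _; rewrite subrr powRr0 !mul1r.
Qed.

Let cvg_expN (y : R) : expR (- z) @[z --> y] --> expR (- y).
Proof.
have := @continuous_expRN R 1 y.
rewrite (_ : (fun z => expR (- (1 * z))) = (fun z => expR (- z))).
  exact.
by apply/funext => z; rewrite mul1r.
Qed.

Lemma cvgy_powR_expR (e : R) : x `^ e * expR (- x) @[x --> +oo] --> (0 : R).
Proof.
have h2 : (0 : R) < 2^-1 by rewrite invr_gt0.
have [K K0 HK] := powR_le_expR e h2.
apply: (@squeeze_cvgr _ _ _ _ (cst 0) (fun x => K * expR (- (2^-1 * x)))).
- near=> x; have x1 : 1 <= x by near: x; exact: nbhs_pinfty_ge.
  rewrite mulr_ge0 ?powR_ge0 ?expR_ge0//=.
  have -> : - (2^-1 * x) = 2^-1 * x + - x by field.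
  by rewrite expRD mulrA ler_wpM2r ?expR_ge0// HK.
- exact: cvg_cst.
- by rewrite -[X in _ --> X](mulr0 K); apply: cvgMr; exact: cvgy_expRN.
Unshelve. all: by end_near. Qed.

Lemma Gamma_funS (x : R) : 0 < x -> Gamma_fun (x + 1) = x * Gamma_fun x.
Proof.
move=> x0; have x10 : 0 < x + 1 by rewrite addr_gt0.
pose f (y : R) := x * (y `^ (x - 1) * expR (- y)) + (-1) * (y `^ (x + 1 - 1) * expR (- y)).
have i1 : mu.-integrable posR (EFin \o (fun y => x * (y `^ (x - 1) * expR (- y)))).
  by apply: integrableRZ => //; exact: integrable_Gamma.
have i2 : mu.-integrable posR (EFin \o (fun y => -1 * (y `^ (x + 1 - 1) * expR (- y)))).
  by apply: integrableRZ => //; exact: integrable_Gamma.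
have := @halfline_FTC _ (fun y : R => y `^ x * expR (- y)) f 0 0.
rewrite subr0 /f RintegralD// !RintegralZl//; try exact: integrable_Gamma.
rewrite mulN1r => h; apply/eqP; rewrite -subr_eq0 -oppr_eq0 opprB; apply/eqP.
apply: h.
- move=> y y0.
  have d2 : is_derive y 1 (fun z : R => expR (- z)) (- expR (- y)).
    have := is_derive_expRN 1 y; rewrite mulN1r mul1r.
    by rewrite (_ : (fun z => _) = (fun z => expR (- z)))//; apply/funext => z; rewrite mul1r.
  have := is_derive_mulr (is_derive1_powR x y0) d2 => h.
  by apply: is_derive_eq; rewrite addrK mulrA mulN1r mulrN.
- move=> y y0; apply: cvgD; apply: cvgMr; apply: cvgM; try exact: continuous_powRl;
    exact: cvg_expN.
- rewrite -[X in _ --> X](mul0r (expR (- 0))); apply: cvgM; first exact: powR_cvg0.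
  by apply: cvg_at_right_filter; exact: cvg_expN.
- exact: cvgy_powR_expR.
- exact: integrableRD.
Qed.

(** The integrand is at least [c] on [[1, 2]]. *)
Lemma Gamma_fun_gt0 (x : R) : 0 < x -> 0 < Gamma_fun x.
Proof.
move=> x0; pose c : R := expR (- 2) / 2.
have c0 : 0 < c by rewrite divr_gt0 ?expR_gt0.
have sI : posR `&` [set` `[1, 2 : R]] = [set` `[1, 2 : R]].
  apply/setIidPr => y /=; rewrite !in_itv/= andbT => /andP[y1 _].
  exact: lt_le_trans y1.
have mc : mu.-integrable posR (EFin \o (cst c \_ [set` `[1, 2 : R]])).
  rewrite -restrict_EFin; apply/integrable_restrict => //; rewrite sI.
  apply: continuous_compact_integrable; first exact: segment_compact.
  by apply: continuous_subspaceT; exact: cst_continuous.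
apply: (@lt_le_trans _ _ (\int[mu]_(y in posR) (cst c \_ [set` `[1, 2 : R]]) y)).
  rewrite -Rintegral_mkcondr sI Rintegral_cst// mulr_gt0//.
  have h : lebesgue_measure [set` `[1, 2 : R]] = 1%E.
    by rewrite lebesgue_measure_itv/= lte_fin ltr1n -EFinB; congr EFin; ring.
  by rewrite (_ : fine _ = fine 1%E)//; congr fine; exact: h.
apply: le_Rintegral => //; first exact: integrable_Gamma.
move=> y; rewrite /= in_itv/= andbT => y0; rewrite patchE.
case: ifPn => [|_]; last by rewrite mulr_ge0 ?powR_ge0 ?expR_ge0.
rewrite inE/= in_itv/= => /andP[y1 y2]; rewrite /c mulrC; apply: ler_pM.
- by rewrite invr_ge0.
- exact: expR_ge0.
- rewrite powRB ?(gt_eqF y0) ?implybT// powRr1 ?(ltW y0)//.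
  apply: (@le_trans _ _ y^-1); first by rewrite lef_pV2 ?posrE.
  rewrite ler_peMl ?invr_ge0 ?(ltW y0)//.
  by rewrite -(powRr0 y); apply: ler_powR => //; exact: ltW.
- by rewrite ler_expR lerN2.
Qed.

End Gamma.

Section gamma_coefficient.
Context {R : realType}.
Implicit Types (a p : R).

(** [a `^ p / Gamma p], written so that it makes sense, and is smooth, also at
    the pole [p = 0] of the Gamma function. *)
Definition gamma_coef0 a p : R := expR (p * ln a) / Gamma_fun (p + 1).

Definition gamma_coef a p : R := p * gamma_coef0 a p.

Lemma gamma_coefE a p : 0 < a -> 0 < p -> gamma_coef a p = a `^ p / Gamma_fun p.
Proof.
move=> a0 p0; rewrite /gamma_coef /gamma_coef0 Gamma_funS// invfM /powR gt_eqF//.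
by rewrite mulrCA [X in _ * X]mulrA mulfV ?gt_eqF// mul1r.
Qed.

Lemma diff_on_gamma_coef0 a n : diff_on (-1) n (gamma_coef0 a).
Proof.
apply: diff_on_mul.
  pose f j (p : R) := ln a ^+ j * expR (p * ln a).
  apply: (@diff_on_ext _ _ _ (f 0)); first by move=> p _; rewrite /f expr0 mul1r.
  apply: (@dseq_diff_on _ _ f n 0) => j p _.
  have := is_deriveZ (ln a ^+ j) (is_derive1_comp (is_derive_expR _) (is_derive_mulrl (ln a) p)).
  rewrite /GRing.scale/= => h; apply: is_derive_eq.
  by rewrite /f exprS; ring.
pose g j (p : R) := Mellin 1 (cst 1) j (p + 1).
have p10 p : -1 < p -> 0 < p + 1 by rewrite -ltrBlDr sub0r.
apply: diff_on_inv.
  by move=> p p1; rewrite gt_eqF// Gamma_fun_gt0// p10.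
apply: (@diff_on_ext _ _ _ (g 0)); first by move=> p _; rewrite /g Gamma_funE.
apply: (@dseq_diff_on _ _ g n 0) => j p p1.
have d1 : is_derive p 1 (fun p : R => p + 1) 1.
  have := is_deriveD (is_derive_id p 1) (is_derive_cst (1 : R) p 1).
  by rewrite addr0.
have := @is_derive1_comp _ _ (fun y => y + 1) _ _ _ (dseq_Gamma j (p10 _ p1)) d1.
by rewrite mulr1.
Qed.

Lemma diff_on_id z n : diff_on z n (@id R).
Proof.
case: n => // n; exists (fun=> 1) => [x _|]; first exact: is_derive_id.
elim: n (1 : R) => // n ih r; exists (fun=> 0) => [x _|]; last exact: ih.
exact: is_derive_cst.
Qed.

Definition gamma_coef_seq a (j : nat) : R -> R := derive1n j (gamma_coef a).

Lemma dseq_gamma_coef a : dseq (-1) (gamma_coef_seq a).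
Proof.
apply: diff_on_dseq => n; apply: diff_on_mul; first exact: diff_on_id.
exact: diff_on_gamma_coef0.
Qed.

(** This is where the digamma function enters: [ln a - digamma] is the
    logarithmic derivative of the normalising factor of the gamma density. *)
Lemma gamma_coef_seq1 a p : 0 < a -> 0 < p ->
  gamma_coef_seq a 1 p = (ln a - digamma p) * gamma_coef a p.
Proof.
move=> a0 p0.
have G0 := Gamma_fun_gt0 p0.
have d1 : is_derive p 1 (fun p : R => expR (p * ln a)) (expR (p * ln a) * ln a).
  exact: (is_derive1_comp (is_derive_expR _) (is_derive_mulrl (ln a) p)).
have dG : is_derive p 1 (@Gamma_fun R) (derive1 (@Gamma_fun R) p).
  have := dseq_Gamma 0 p0; rewrite (_ : Mellin 1 _ 0 = @Gamma_fun R); last first.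
    by apply/funext => q; rewrite Gamma_funE.
  by move=> [dG _]; rewrite derive1E; exact: DeriveDef.
have d2 := is_derive_inv (lt0r_neq0 G0) dG.
have := is_derive_mulr d1 d2.
move/(@eq_gt_is_derive _ _ (gamma_coef a) _ _ _ p0) => h.
rewrite /gamma_coef_seq derive1n1 derive1E.
have [|_ ->] := h _.
  by move=> y y0; rewrite gamma_coefE// /powR gt_eqF.
rewrite gamma_coefE// /powR gt_eqF// /digamma.
by field; rewrite gt_eqF.
Qed.

Lemma gamma_coef_00 a : gamma_coef a 0 = 0.
Proof. by rewrite /gamma_coef mul0r. Qed.

Lemma gamma_coef0_0 a : gamma_coef0 a 0 = 1.
Proof. by rewrite /gamma_coef0 mul0r expR0 add0r Gamma_fun1 divr1. Qed.

Lemma gamma_coef_seq1_0 a : gamma_coef_seq a 1 0 = 1.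
Proof.
have m10 : -1 < (0 : R) by rewrite oppr_lt0.
have [f' df _] := @diff_on_gamma_coef0 a 1.
have := is_derive_mulr (is_derive_id (0 : R) (1 : R)) (df 0 m10).
rewrite mul0r addr0 mul1r gamma_coef0_0 => -[_ h].
by rewrite /gamma_coef_seq derive1n1 derive1E.
Qed.

Lemma gamma_densityE a l q : 0 < a -> 0 < q -> 0 < l ->
  gamma_density l a q = gamma_coef a q * gamma_kernel a l 0 q.
Proof.
move=> a0 q0 l0; rewrite /gamma_density l0 q0/= gamma_coefE//.
by rewrite /gamma_kernel expr0 mul1r mulrA.
Qed.

End gamma_coefficient.


(** * Riemann-Liouville integrals and their derivative *)

Section fractional_integral.
Context {R : realType}.
Notation mu := (@lebesgue_measure R).
Implicit Types (g z q : R) (f : nat -> R -> R).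

Definition cont_right z (f : R -> R) : Prop :=
  forall x, z < x -> {for x, continuous f}.

Lemma dseq_cont_right z f j : dseq z f -> cont_right z (f j).
Proof. by move=> df x zx; exact: dseq_continuous df zx. Qed.

Lemma cont_right_bounded z phi q : z < 0 -> cont_right z phi ->
  exists2 B, 0 <= B & forall s, 0 <= s <= q -> `|phi s| <= B.
Proof.
move=> z0 cf; have [q0|q0] := ltP q 0.
  by exists 0 => // s /andP[s0 sq]; have := le_lt_trans (le_trans s0 sq) q0;
    rewrite ltxx.
have cfn : {within `[0, q], continuous (fun s => `|phi s|)}.
  apply: continuous_in_subspaceT => x; rewrite inE/= in_itv/= => /andP[x0 _].
  by apply: cvg_norm; apply: cf; exact: lt_le_trans x0.
have [c cq hc] := EVT_max q0 cfn.
by exists `|phi c| => // s sq; apply: hc; rewrite in_itv.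
Qed.

Lemma cont_right_measurable z phi (q : R) : z < 0 -> cont_right z phi ->
  measurable_fun [set` `]0, q[] phi.
Proof.
move=> z0 cf; apply: open_continuous_measurable_fun; first exact: interval_open.
move=> x; rewrite inE/= in_itv/= => /andP[x0 _].
by apply: cf; exact: lt_trans x0.
Qed.

Lemma is_derive_powR_sub e q s : s < q ->
  is_derive s 1 (fun s => (q - s) `^ e) (- (e * (q - s) `^ (e - 1))).
Proof.
move=> sq.
have d1 : is_derive s 1 (fun s => q - s) (-1).
  have := is_deriveB (is_derive_cst q s 1) (is_derive_id s (1 : R)).
  by rewrite sub0r.
have qs0 : 0 < q - s by rewrite subr_gt0.
have := @is_derive1_comp _ (fun x : R => x `^ e) (fun s => q - s) _ _ _ (is_derive1_powR e qs0) d1.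
by rewrite mulrN1.
Qed.

Lemma continuous_powR_sub e q s : s < q -> {for s, continuous (fun s => (q - s) `^ e)}.
Proof.
move=> sq; apply/differentiable_continuous/derivable1_diffP.
by have [] := is_derive_powR_sub e sq.
Qed.

Lemma cvg_powR_sub e q : 0 < e -> (q - s) `^ e @[s --> q^'-] --> (0 : R).
Proof.
move=> e0; apply/cvg_at_leftP => u [uq uc].
have /cvg_at_rightP h := powR_cvg0 e0.
apply: (h (fun n => q - u n)); split.
  by move=> n; rewrite subr_gt0.
by rewrite -(subrr q); apply: cvgB => //; exact: cvg_cst.
Qed.

Lemma cvg_powR_sub0 e q : 0 < q -> (q - s) `^ e @[s --> 0^'+] --> q `^ e.
Proof.
move=> q0; apply: cvg_at_right_filter.
by have := continuous_powR_sub (e := e) q0; rewrite /prop_for /continuous_at subr0.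
Qed.

Lemma integrable_powR_sub g q : -1 < g -> 0 < q ->
  mu.-integrable [set` `]0, q[] (EFin \o (fun s => (q - s) `^ g)).
Proof.
move=> g1 q0; have g10 : 0 < g + 1 by rewrite -ltrBlDr sub0r.
apply: (@ge0_itvoo_integrable _ 0 q (fun s => (- (g + 1)^-1) * (q - s) `^ (g + 1)) _
  ((- (g + 1)^-1) * q `^ (g + 1)) 0); first exact: q0.
- move=> s /andP[_ sq].
  have := is_deriveZ (- (g + 1)^-1) (is_derive_powR_sub (g + 1) sq) => h.
  apply: is_derive_eq; rewrite /GRing.scale/= addrK.
  by field; rewrite gt_eqF.
- by move=> s /andP[_ sq]; exact: continuous_powR_sub.
- by apply: cvgMr; exact: cvg_powR_sub0.
- by rewrite -[X in _ --> X](mulr0 (- (g + 1)^-1)); apply: cvgMr; exact: cvg_powR_sub.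
- by move=> s _; exact: powR_ge0.
Qed.

(** The Riemann-Liouville integral of order [g + 1], without its factor
    [1 / Gamma (g + 1)]. *)
Definition frac_int g (phi : R -> R) q : R :=
  \int[mu]_(s in `]0, q[) ((q - s) `^ g * phi s).

Lemma measurable_powR_sub g q (D : set R) : measurable D ->
  measurable_fun D (fun s => (q - s) `^ g).
Proof.
move=> mD; apply: (@measurableT_comp _ _ _ _ _ _ (fun x : R => x `^ g)).
  exact: measurable_powR.
exact: measurable_funB.
Qed.

Lemma integrable_frac_int g z phi q : -1 < g -> z < 0 -> cont_right z phi -> 0 < q ->
  mu.-integrable [set` `]0, q[] (EFin \o (fun s => (q - s) `^ g * phi s)).
Proof.
move=> g1 z0 cf q0; have [B B0 hB] := cont_right_bounded q z0 cf.
apply: (dominated_integrableR _ _ (integrableRZ B _ (integrable_powR_sub g1 q0))) => //.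
- apply: measurable_funM; first exact: measurable_powR_sub.
  exact: cont_right_measurable cf.
- move=> s; rewrite /= in_itv/= => /andP[s0 sq].
  rewrite normrM mulrC (ger0_norm (powR_ge0 _ _)) ler_wpM2r ?powR_ge0//.
  by rewrite hB// !ltW.
Qed.

Lemma frac_int_by_parts g z f q : -1 < g -> z < 0 -> dseq z f -> 0 < q ->
  (g + 1) * frac_int g (f 0) q = q `^ (g + 1) * f 0 0 + frac_int (g + 1) (f 1) q.
Proof.
move=> g1 z0 df q0; have g10 : 0 < g + 1 by rewrite -ltrBlDr sub0r.
have g11 : -1 < g + 1 by rewrite (lt_trans _ g10)// oppr_lt0.
have i0 := integrable_frac_int g1 z0 (dseq_cont_right (j := 0) df) q0.
have i1 := integrable_frac_int g11 z0 (dseq_cont_right (j := 1) df) q0.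
have i0' : mu.-integrable [set` `]0, q[]
    (EFin \o (fun s => (g + 1) * ((q - s) `^ g * f 0 s))) by exact: integrableRZ.
have i1' : mu.-integrable [set` `]0, q[]
    (EFin \o (fun s => -1 * ((q - s) `^ (g + 1) * f 1 s))) by exact: integrableRZ.
pose ph s := (g + 1) * ((q - s) `^ g * f 0 s) + -1 * ((q - s) `^ (g + 1) * f 1 s).
have : \int[mu]_(s in `]0, q[) ph s = 0 - (- (q `^ (g + 1) * f 0 0)).
  apply: (@itvoo_FTC _ 0 q (fun s => - ((q - s) `^ (g + 1) * f 0 s))) => //.
  - move=> s /andP[s0 sq].
    have := is_deriveN (is_derive_mulr (is_derive_powR_sub (g + 1) sq)
      (df 0 s (lt_trans z0 s0))) => h.
    by apply: is_derive_eq; rewrite /ph addrK; ring.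
  - move=> s /andP[s0 sq]; have zs := lt_trans z0 s0.
    apply: cvgD; apply: cvgMr; apply: cvgM; try exact: continuous_powR_sub;
      exact: dseq_continuous df zs.
  - apply: cvgN; apply: cvgM.
      exact: cvg_powR_sub0.
    by apply: cvg_at_right_filter; exact: dseq_continuous df z0.
  - rewrite -oppr0 -(mul0r (f 0 q)); apply: cvgN; apply: cvgM.
      exact: cvg_powR_sub.
    by apply: cvg_at_left_filter; exact: dseq_continuous df (lt_trans z0 q0).
  - exact: integrableRD.
rewrite /ph RintegralD// !RintegralZl// -/(frac_int g (f 0) q).
by rewrite -/(frac_int (g + 1) (f 1) q) mulN1r sub0r opprK => <-; rewrite subrK.
Qed.

(** Extended by zero to [u <= 0], the power allows integration over a fixed
    interval, so that the upper end [x] enters the integrand only. *)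
Let ppow (e u : R) : R := if 0 < u then u `^ e else 0.

Let is_derive_ppow (e u : R) : 1 < e -> is_derive u 1 (ppow e) (e * ppow (e - 1) u).
Proof.
move=> e1; have e10 : 0 < e - 1 by rewrite subr_gt0.
have [u0|u0|->] := ltgtP u 0.
- rewrite /ppow (lt_gtF u0) mulr0.
  apply: near_eq_is_derive (is_derive_cst 0 u 1).
  near=> x; rewrite /cst ifF//; apply: lt_gtF; near: x.
  exact: lt_nbhsl.
- rewrite {2}/ppow u0; apply: near_eq_is_derive (is_derive1_powR e u0).
  by near=> x; rewrite /ppow ifT//; near: x; exact: lt_nbhsr.
- rewrite {2}/ppow ltxx mulr0.
  have h : h^-1 *: (ppow e (h *: 1 + 0) - ppow e 0) @[h --> 0^'] --> (0 : R).
    apply/cvgrPdist_lt => eps eps0; near=> h.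
    rewrite sub0r normrN /GRing.scale/= mulr1 addr0 {2}/ppow ltxx subr0.
    rewrite normrM /ppow; case: ifPn => [h0|_]; last by rewrite normr0 mulr0.
    rewrite normfV (gtr0_norm h0) (ger0_norm (powR_ge0 _ _)).
    rewrite -powR_inv1 ?(ltW h0)// -powRD ?(gt_eqF h0) ?implybT// addrC.
    have -> : eps = (eps `^ (e - 1)^-1) `^ (e - 1).
      by rewrite -powRrM mulVf ?gt_eqF// powRr1// ltW.
    rewrite gt0_ltr_powR ?nnegrE ?powR_ge0 ?(ltW h0)//.
    rewrite -[h]gtr0_norm//.
    near: h; apply: dnbhs0_lt; exact: powR_gt0.
  split; first by apply/cvg_ex; exists 0.
  by apply/cvg_lim => //.
Unshelve. all: by end_near. Qed.

Let measurable_ppow_sub e q (D : set R) : measurable D ->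
  measurable_fun D (fun s => ppow e (q - s)).
Proof.
move=> mD; rewrite /ppow.
rewrite (_ : (fun s => _) = (fun s => (q - s) `^ e) \_ [set` `]-oo, q[]).
  apply/measurable_restrict => //; apply: measurable_powR_sub.
  exact: measurableI.
apply/funext => s; rewrite patchE subr_gt0.
by case: ifPn => sq; [rewrite mem_set//= in_itv|rewrite memNset//= in_itv/=; apply/negP].
Qed.

Let frac_intE e phi x Q : 0 < x < Q ->
  frac_int e phi x = \int[mu]_(s in `]0, Q[) (ppow e (x - s) * phi s).
Proof.
move=> /andP[x0 xQ].
rewrite (_ : \int[mu]_(s in `]0, Q[) _ =
    \int[mu]_(s in `]0, Q[) (((fun s => (x - s) `^ e * phi s) \_ [set` `]0, x[]) s)).
  rewrite -Rintegral_mkcondr (_ : _ `&` _ = [set` `]0, x[])//.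
  apply/setIidPr => s /=; rewrite !in_itv/= => /andP[-> sx]/=.
  exact: lt_trans xQ.
apply: eq_Rintegral => s; rewrite inE/= in_itv/= => /andP[s0 sQ].
rewrite patchE /ppow subr_gt0; case: ifPn => sx.
  by rewrite mem_set//= in_itv/= s0.
by rewrite memNset ?mul0r//= in_itv/= (negbTE sx) andbF.
Qed.

(** For [1 < e] the kernel vanishes at the moving end to first order, and the
    derivative of the extended kernel is bounded. *)
Lemma is_derive_frac_int_gt1 e z phi q : 1 < e -> z < 0 -> cont_right z phi -> 0 < q ->
  is_derive q 1 (frac_int e phi) (e * frac_int (e - 1) phi q).
Proof.
move=> e1 z0 cf q0; pose Q := q + 1.
have q0Q : 0 < q < Q by rewrite q0 ltrDl ltr01.
have e0 : 0 < e := lt_trans ltr01 e1.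
have [B B0 hB] := cont_right_bounded Q z0 cf.
have mf d x : measurable_fun [set` `]0, Q[] (fun s => ppow d (x - s) * phi s).
  apply: measurable_funM; first exact: measurable_ppow_sub.
  exact: cont_right_measurable cf.
have bnd d x s : 0 < d -> 0 < x < Q -> 0 < s < Q ->
    `|ppow d (x - s) * phi s| <= Q `^ d * B.
  move=> d0 /andP[x0 xQ] /andP[s0 sQ]; rewrite normrM ler_pM//; last first.
    by rewrite hB// !ltW.
  rewrite /ppow; case: ifPn => [xs|_]; last by rewrite normr0 powR_ge0.
  rewrite ger0_norm ?powR_ge0//; apply: ge0_ler_powR; rewrite ?nnegrE ?ltW//.
    exact: lt_trans xQ.
  by rewrite (le_lt_trans _ xQ)// gerBl ltW.
have icst (k : R) : mu.-integrable [set` `]0, Q[] (EFin \o (fun=> k)).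
  have Q0 : 0 < Q by case/andP: q0Q => *; exact: lt_trans q0 _.
  apply: eq_integrableR (integrableRZ k _ (integrable_powR_sub (g := 0) _ Q0)) => //.
    by move=> s _; rewrite powRr0 mulr1.
have -> : e * frac_int (e - 1) phi q =
    \int[mu]_(s in `]0, Q[) (e * ppow (e - 1) (q - s) * phi s).
  rewrite (frac_intE _ _ q0Q) -RintegralZl//.
    by apply: eq_Rintegral => s _; rewrite mulrA.
  apply: (dominated_integrableR _ _ (icst (Q `^ (e - 1) * B))) => //.
    exact: mf.
  by move=> s; rewrite /= in_itv/= => sQ; apply: bnd; rewrite ?subr_gt0.
apply: (@near_eq_is_derive _ _ _ (fun x => \int[mu]_(s in `]0, Q[) (ppow e (x - s) * phi s))).
  near=> x; apply/esym/frac_intE; apply/andP; split; near: x.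
    exact: lt_nbhsr.
  by apply: lt_nbhsl; rewrite ltrDl.
apply: (@is_derive_under_integral _ _ _ mu _ (fun x s => ppow e (x - s) * phi s)
  (fun x s => e * ppow (e - 1) (x - s) * phi s) (fun=> e * (Q `^ (e - 1) * B)) _ 0 Q) => //.
- move=> x xQ; apply: (dominated_integrableR _ _ (icst (Q `^ e * B))) => //.
    exact: mf.
  by move=> s; rewrite /= in_itv/= => sQ; exact: bnd.
- move=> x s xQ _.
  have d1 : is_derive x 1 (fun x => x - s) 1.
    have := is_deriveB (is_derive_id x (1 : R)) (is_derive_cst s x 1).
    by rewrite subr0.
  have := @is_derive1_comp _ (ppow e) (fun x => x - s) _ _ _ (is_derive_ppow (x - s) e1) d1.
  rewrite mulr1 => d2; have := is_derive_mulr d2 (is_derive_cst (phi s) x 1).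
  by rewrite mulr0 addr0.
- move=> x s xQ; rewrite /= in_itv/= => sQ.
  rewrite -mulrA normrM (gtr0_norm e0) ler_pM2l//.
  by apply: bnd; rewrite ?subr_gt0.
Unshelve. all: by end_near. Qed.

(** Differentiating under the integral sign is only possible once the
    singularity of [(q - s) `^ g] at [s = q] has been integrated away, hence the
    two integrations by parts. *)
Lemma is_derive_frac_int g z f q : -1 < g -> z < 0 -> dseq z f -> 0 < q ->
  is_derive q 1 (frac_int g (f 0)) (frac_int g (f 1) q + f 0 0 * q `^ g).
Proof.
move=> g1 z0 df q0; have g10 : 0 < g + 1 by rewrite -ltrBlDr sub0r.
have g11 : -1 < g + 1 by rewrite (lt_trans _ g10)// oppr_lt0.
have g21 : 1 < g + 1 + 1 by rewrite ltrDr.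
have g20 : 0 < g + 1 + 1 := lt_trans ltr01 g21.
have df1 := dseq_shift df.
pose F x := (g + 1)^-1 * (f 0 0 * x `^ (g + 1) +
  (g + 1 + 1)^-1 * (f 1 0 * x `^ (g + 1 + 1) + frac_int (g + 1 + 1) (f 2) x)).
apply: (@eq_gt_is_derive _ F _ 0) => // [y y0|].
  have h1 := frac_int_by_parts g1 z0 df y0.
  have h2 := frac_int_by_parts g11 z0 df1 y0.
  apply: (mulfI (lt0r_neq0 g10)); rewrite /F mulrA mulfV ?mul1r ?gt_eqF// h1.
  rewrite mulrC; congr (_ + _); apply: (mulfI (lt0r_neq0 g20)).
  rewrite -[f 1]/(shift_seq f 0) h2 mulrA mulfV ?mul1r ?gt_eqF//.
  by rewrite mulrC.
have d3 := is_derive_frac_int_gt1 g21 z0 (dseq_cont_right (j := 2) df) q0.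
have d2 := is_derive1_powR (g + 1 + 1) q0; have d1 := is_derive1_powR (g + 1) q0.
have := is_deriveZ (g + 1)^-1 (is_derive_addr (is_deriveZ (f 0 0) d1)
  (is_deriveZ (g + 1 + 1)^-1 (is_derive_addr (is_deriveZ (f 1 0) d2) d3))) => h.
apply: is_derive_eq; rewrite /GRing.scale/= !addrK.
have := frac_int_by_parts g1 z0 df1 q0; rewrite /shift_seq => h1.
apply: (mulfI (lt0r_neq0 g10)); rewrite [RHS]mulrDr h1.
by field; rewrite !gt_eqF.
Qed.

End fractional_integral.

(** * Riemann-Liouville derivatives of smooth functions *)

Section Riemann_Liouville_smooth.
Context {R : realType}.
Notation mu := (@lebesgue_measure R).
Implicit Types (g z q : R) (f : nat -> R -> R).

Definition powR_deriv g (j : nat) q : R :=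
  (\prod_(i < j) (g - i%:R)) * q `^ (g - j%:R).

Lemma dseq_powR_deriv g : dseq 0 (powR_deriv g).
Proof.
move=> j q q0.
have := is_deriveZ (\prod_(i < j) (g - i%:R)) (is_derive1_powR (g - j%:R) q0).
rewrite /GRing.scale/= => h; apply: is_derive_eq.
rewrite /powR_deriv big_ord_recr/= mulrA; congr (_ * _ `^ _).
by rewrite -natr1 opprD addrA.
Qed.

(** With exponent [0] the weight is [1] and this is the fundamental theorem of
    calculus. *)
Lemma frac_int_derivative z f q : z < 0 -> dseq z f -> 0 < q ->
  frac_int 0 (f 1) q = f 0 q - f 0 0.
Proof.
move=> z0 df q0; have i1 : -1 < (0 : R) by rewrite oppr_lt0.
have := integrable_frac_int i1 z0 (dseq_cont_right (j := 1) df) q0.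
have E s : (q - s) `^ 0 * f 1 s = f 1 s by rewrite powRr0 mul1r.
move=> i2; transitivity (\int[mu]_(s in `]0, q[) f 1 s).
  by apply: eq_Rintegral => s _; rewrite E.
apply: (@itvoo_FTC _ 0 q (f 0)).
- exact: q0.
- by move=> s /andP[s0 _]; apply: df; exact: lt_trans s0.
- by move=> s /andP[s0 _]; apply: (dseq_continuous df); exact: lt_trans s0.
- by apply: cvg_at_right_filter; exact: dseq_continuous df z0.
- by apply: cvg_at_left_filter; exact: dseq_continuous df (lt_trans z0 q0).
- by apply: eq_integrableR i2 => // s _; rewrite E.
Qed.

(** The [m]-th derivative of [frac_int g (f 0)], when [f] is the sequence of
    the derivatives of [f 0]: each derivative moves under the integral and
    leaves a boundary term at the origin, itself to be differentiated. *)
Fixpoint frac_deriv g f (m : nat) : R -> R :=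
  match m with
  | 0 => frac_int g (f 0)
  | m'.+1 => fun q => frac_deriv g (shift_seq f) m' q + f 0 0 * powR_deriv g m' q
  end.

Lemma dseq_frac_deriv g z f : -1 < g -> z < 0 -> dseq z f ->
  dseq 0 (frac_deriv g f).
Proof.
move=> g1 z0 df m q q0; elim: m f df => [|m ih] f df /=.
  have := is_derive_frac_int g1 z0 df q0.
  by rewrite /powR_deriv big_ord0 mul1r subr0.
apply: is_derive_addr; first exact/ih/dseq_shift.
exact: is_deriveZ (dseq_powR_deriv g m q0).
Qed.

Lemma frac_derivD g z f1 f2 m q : -1 < g -> z < 0 -> dseq z f1 -> dseq z f2 ->
  0 < q ->
  frac_deriv g (fun j x => f1 j x + f2 j x) m q =
  frac_deriv g f1 m q + frac_deriv g f2 m q.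
Proof.
move=> g1 z0 d1 d2 q0; elim: m f1 f2 d1 d2 => [|m ih] f1 f2 d1 d2 /=.
  rewrite /frac_int -RintegralD//.
  - by apply: eq_Rintegral => s _; rewrite mulrDr.
  - exact: integrable_frac_int g1 z0 (dseq_cont_right (j := 0) d1) q0.
  - exact: integrable_frac_int g1 z0 (dseq_cont_right (j := 0) d2) q0.
have := ih _ _ (dseq_shift d1) (dseq_shift d2); rewrite /shift_seq/= => ->.
by ring.
Qed.

Lemma frac_derivZ g z f (r : R) m q : -1 < g -> z < 0 -> dseq z f -> 0 < q ->
  frac_deriv g (fun j x => r * f j x) m q = r * frac_deriv g f m q.
Proof.
move=> g1 z0 df q0; elim: m f df => [|m ih] f df /=.
  have i1 := integrable_frac_int g1 z0 (dseq_cont_right (j := 0) df) q0.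
  rewrite /frac_int -RintegralZl //.
  by apply: eq_Rintegral => s _; rewrite mulrCA.
have := ih _ (dseq_shift df); rewrite /shift_seq/= => ->.
by ring.
Qed.

Lemma frac_deriv_Leibniz g z c u m q : -1 < g -> z < 0 -> dseq z c -> dseq z u ->
  0 < q ->
  frac_deriv g (shift_seq (Leibniz c u)) m q =
  frac_deriv g (Leibniz (shift_seq c) u) m q +
  frac_deriv g (Leibniz c (shift_seq u)) m q.
Proof.
move=> g1 z0 dc du q0; rewrite -(frac_derivD m g1 z0 _ _ q0)//.
- by apply: dseq_Leibniz => //; exact: dseq_shift.
- by apply: dseq_Leibniz => //; exact: dseq_shift.
Qed.

(** Number of ordinary derivatives applied to the fractional integral, and
    exponent of the kernel of that integral. *)
Definition RL_order (nu : R) : nat := if nu < 0 then 0 else (Num.truncn nu).+1.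

Lemma nonint_pred (nu : R) : nu = 0 \/ nu != (Num.truncn nu)%:R ->
  nu - 1 < 0 \/ nu - 1 != (Num.truncn (nu - 1))%:R.
Proof.
move=> nuZ; have [w0|w0] := ltP (nu - 1) 0; [by left|right].
case: nuZ => [nu00|]; first by move: w0; rewrite nu00; lra.
apply: contra_neq => wE.
have -> : nu = (Num.truncn (nu - 1)).+1%:R by rewrite -natr1 -wE subrK.
by rewrite natrK.
Qed.

Definition RL_exponent (nu : R) : R := (RL_order nu)%:R - 1 - nu.

Lemma RL_order_succ (nu : R) : 0 <= nu -> RL_order nu = (RL_order (nu - 1)).+1.
Proof.
move=> nu0; rewrite /RL_order (le_gtF nu0) subr_lt0; case: ltP => nu1.
  by congr S; apply: truncn_def; rewrite nu0.
have w0 : 0 <= nu - 1 by rewrite subr_ge0.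
have /andP[h1 h2] := truncn_itv w0.
congr S; apply: truncn_def.
by rewrite -[(Num.truncn (nu - 1)).+2%:R]natr1 -[X in X <= _]natr1 -lerBrDr h1 -ltrBlDr h2.
Qed.

Lemma RL_exponent_gt (nu : R) : -1 < RL_exponent nu.
Proof.
rewrite /RL_exponent /RL_order; case: ifPn => nu0.
  by rewrite sub0r ltrDl oppr_gt0.
by rewrite -addrA addrC -addrA ltrDl addrC subr_gt0 truncnS_gt.
Qed.

(** Smoothness across the origin allows every derivative to be taken by
    [is_derive_frac_int]; negative and non-integer orders then obey one
    formula. *)
Lemma RL_smooth (nu : R) z f F p : nu < 0 \/ nu != (Num.truncn nu)%:R ->
  z < 0 -> dseq z f -> (forall s, 0 < s -> F s = f 0 s) -> 0 < p ->
  RL_exists nu F p /\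
  RL_deriv nu F p = (Gamma_fun ((RL_order nu)%:R - nu))^-1 *
    frac_deriv (RL_exponent nu) f (RL_order nu) p.
Proof.
move=> nuZ z0 df Ff p0.
have g1 := RL_exponent_gt nu.
rewrite /RL_exists /RL_deriv; move: g1 nuZ; rewrite /RL_exponent /RL_order.
case: ifP => nu0 g1 nuZ.
  rewrite sub0r in g1 *; rewrite sub0r addrC /RL_integral/=; split.
    apply: eq_integrableR (integrable_frac_int g1 z0 (dseq_cont_right (j := 0) df) p0) => //.
    by move=> s; rewrite /= in_itv/= => /andP[s0 _]; rewrite Ff// (addrC (- nu)).
  congr (_ * _); apply: eq_Rintegral => s; rewrite inE/= in_itv/= => /andP[s0 _].
  by rewrite Ff// (addrC (- nu)).
case: nuZ => [//|nuZ].
rewrite (negbTE nuZ).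
set k := Num.truncn nu in nuZ g1 *.
have kE : k.+1%:R - 1 - nu = k%:R - nu by rewrite -natr1 addrK.
rewrite kE in g1 *.
have wE q s : (q - s) `^ (k%:R - nu) * f 0 s = f 0 s / (q - s) `^ (nu - k.+1%:R + 1).
  rewrite -powRN mulrC; congr (_ * _ `^ _).
  by rewrite -natr1; ring.
have kernE q : 0 < q -> RL_kernel k.+1 nu F q = frac_deriv (k%:R - nu) f 0 q.
  move=> q0; apply: eq_Rintegral => s; rewrite inE/= in_itv/= => /andP[s0 _].
  by rewrite Ff// wE.
have dk := dseq_frac_deriv g1 z0 df.
split.
  split; last exact: dseq_nderivable dk kernE p0.
  apply: filterS (near_gt p0) => q q0.
  apply: eq_integrableR (integrable_frac_int g1 z0 (dseq_cont_right (j := 0) df) q0) => //.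
  by move=> s; rewrite /= in_itv/= => /andP[s0 _]; rewrite Ff// wE.
by rewrite (dseq_derive1n dk kernE).
Qed.

Lemma RL_smooth_nat (m : nat) z f F p : dseq z f ->
  (forall s, z < s -> F s = f 0 s) -> z < p ->
  RL_exists (m%:R : R) F p /\ RL_deriv (m%:R : R) F p = f m p.
Proof.
move=> df Ff zp; rewrite /RL_exists /RL_deriv ltrn0 natrK eqxx; split.
  exact: dseq_nderivable df Ff zp.
exact: dseq_derive1n df Ff m p zp.
Qed.

(** The logarithm is unbounded at the origin. *)
Lemma not_integrable_inv (G : R -> R) (k d q : R) : 0 < k -> 0 < d <= q ->
  (forall s, 0 < s < d -> k / s <= `|G s|) ->
  ~ mu.-integrable [set` `]0, q[] (EFin \o G).
Proof.
move=> k0 /andP[d0 dq] hG /integrableP[mG Gy].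
have ge0 : (0 <= \int[mu]_(x in [set` `]0%R, q[]) `|(EFin \o G) x|)%E.
  by apply: integral_ge0.
have : (\int[mu]_(x in [set` `]0%R, q[]) `|(EFin \o G) x|)%E \is a fin_num.
  by rewrite ge0_fin_numE.
move=> /fineK Gfin.
set I := fine _ in Gfin.
(* on ]e, d[ the function k / x has integral k * n, which exceeds I *)
pose n := (Num.truncn (I / k)).+1; pose e := d * expR (- n%:R).
have e0 : 0 < e by rewrite mulr_gt0// expR_gt0.
have ed : e < d by rewrite gtr_pMr// expR_lt1 oppr_lt0 ltr0n.
have h1 : (\int[mu]_(x in [set` `]e, d[]) (k / x)%:E = (k * ln d - k * ln e)%:E)%E.
  apply: (@ge0_itvoo_FTC _ e d (fun x => k * ln x)) => //.
  - move=> x /andP[ex _]; have x0 := lt_trans e0 ex.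
    by have := is_deriveZ k (is_derive1_ln x0).
  - move=> x /andP[ex _]; have x0 := lt_trans e0 ex.
    by apply: cvgMr; apply: cvgV => //; rewrite gt_eqF.
  - by apply: cvg_at_right_filter; apply: cvgMr; exact: continuous_ln.
  - by apply: cvg_at_left_filter; apply: cvgMr; exact: continuous_ln.
  - by move=> x /andP[ex _]; rewrite divr_ge0 ?ltW// (lt_trans e0 ex).
have : (\int[mu]_(x in [set` `]e, d[]) (k / x)%:E <= I%:E)%E.
  rewrite Gfin.
  apply: (@le_trans _ _ (\int[mu]_(x in [set` `]e, d[]) `|(EFin \o G) x|)%E).
    apply: ge0_le_integral => //.
    - move=> x; rewrite /= in_itv/= => /andP[ex _].
      by rewrite lee_fin divr_ge0 ?ltW// (lt_trans e0 ex).
    - apply/measurable_EFinP; apply: measurable_funM => //.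
      apply: open_continuous_measurable_fun; first exact: interval_open.
      move=> x; rewrite inE/= in_itv/= => /andP[ex _].
      by apply: cvgV => //; rewrite gt_eqF// (lt_trans e0 ex).
    - apply: measurableT_comp => //; apply: measurable_funS mG => //.
      move=> x; rewrite /= !in_itv/= => /andP[ex xd].
      by rewrite (lt_trans e0 ex) (lt_le_trans xd).
    - move=> x; rewrite /= in_itv/= => /andP[ex xd]; rewrite lee_fin.
      by rewrite hG// (lt_trans e0 ex) xd.
  apply: ge0_subset_integral => //.
  - exact: measurableT_comp.
  - move=> x; rewrite /= !in_itv/= => /andP[ex xd].
    by rewrite (lt_trans e0 ex) (lt_le_trans xd).
rewrite h1 lee_fin /e lnM ?posrE ?expR_gt0// expRK.
have : I / k < n%:R by exact: truncnS_gt.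
rewrite ltr_pdivrMr// => In.
by rewrite leNgt => /negP; apply; rewrite (lt_le_trans In)//; lra.
Qed.

(** The weight of the Riemann-Liouville integral stays away from [0] near the
    origin, so it cannot make a singularity of order [1 / s] integrable. *)
Lemma RL_not_exists (nu k d p : R) F : -1 <= nu ->
  nu < 0 \/ nu != (Num.truncn nu)%:R ->
  0 < k -> 0 < d -> 0 < p -> (forall s, 0 < s < d -> k / s <= F s) ->
  ~ RL_exists nu F p.
Proof.
move=> nu1 nuZ k0 d0 p0 hF.
have main (b : R) (w : R -> R) : 0 <= b -> (forall s, w s = ((p - s) `^ b)^-1) ->
    ~ mu.-integrable [set` `]0, p[] (EFin \o (fun s => w s * F s)).
  move=> b0 wE; apply: (@not_integrable_inv _ ((p `^ b)^-1 * k) (Num.min d p)).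
  - by rewrite mulr_gt0// invr_gt0 powR_gt0.
  - by rewrite lt_min d0 p0/= ge_min lexx orbT.
  - move=> s /andP[s0]; rewrite lt_min => /andP[sd sp].
    have Fs : 0 <= F s by rewrite (le_trans _ (hF s _)) ?s0// divr_ge0// ltW.
    rewrite wE ger0_norm; last by rewrite mulr_ge0 ?invr_ge0 ?powR_ge0.
    rewrite -mulrA ler_pM ?invr_ge0 ?powR_ge0 ?divr_ge0 ?(ltW s0) ?(ltW k0)//.
      rewrite lef_pV2 ?posrE ?powR_gt0 ?subr_gt0//.
      apply: ge0_ler_powR; rewrite ?nnegrE ?subr_ge0 ?(ltW sp) ?(ltW p0)//.
      by rewrite gerBl ltW.
    by rewrite hF// s0.
rewrite /RL_exists; case: ifP => nu0.
  have b0 : 0 <= nu + 1 by rewrite -lerBlDr sub0r.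
  move=> h; apply: (main (nu + 1) (fun s => (p - s) `^ (- nu - 1)) b0 _ h).
  by move=> s; rewrite -powRN opprD.
case: nuZ => [|nuZ]; first by rewrite nu0.
rewrite (negbTE nuZ) => -[/nbhs_singleton h _].
set k1 := Num.truncn nu in h.
have b0 : 0 <= nu - k1.+1%:R + 1.
  rewrite -natr1 opprD addrA subrK subr_ge0.
  by rewrite truncn_le// leNgt nu0.
move: h; apply: contra_not (main _ (fun s => ((p - s) `^ (nu - k1.+1%:R + 1))^-1) b0 _) => //.
by apply: eq_integrableR => // s _; rewrite mulrC.
Qed.

End Riemann_Liouville_smooth.

Section real_Fubini.
Context d1 d2 (T1 : measurableType d1) (T2 : measurableType d2) {R : realType}.
Variables (m1 : {sigma_finite_measure set T1 -> \bar R})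
  (m2 : {sigma_finite_measure set T2 -> \bar R}).

(** The product [a s * b l] is integrable on the product space, hence [f] is. *)
Lemma Rfubini (A : set T1) (B : set T2) (f : T1 -> T2 -> R)
    (a : T1 -> R) (b : T2 -> R) :
  measurable A -> measurable B ->
  measurable_fun (A `*` B) (fun x => f x.1 x.2) ->
  m1.-integrable A (EFin \o a) -> m2.-integrable B (EFin \o b) ->
  (forall s l, A s -> B l -> `|f s l| <= a s * b l) ->
  m1.-integrable A (EFin \o (fun s => \int[m2]_(l in B) f s l)) /\
  \int[m1]_(s in A) (\int[m2]_(l in B) f s l) =
  \int[m2]_(l in B) (\int[m1]_(s in A) f s l).
Proof.
move=> mA mB mf ia ib fab.
have mAB : measurable (A `*` B) by exact: measurableX.
pose F : T1 * T2 -> \bar R := EFin \o ((fun x => f x.1 x.2) \_ (A `*` B)).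
have mF : measurable_fun setT F.
  by apply/measurable_EFinP; exact/(measurable_restrictT _ mAB).
have FE x y : F (x, y) = (if (x \in A) && (y \in B) then f x y else 0)%:E.
  by rewrite /F/= patchE in_setX.
have if1 s : A s -> m2.-integrable B (EFin \o f s).
  move=> As; apply: (dominated_integrableR mB _ (integrableRZ (a s) mB ib)).
    have : measurable_fun setT (fun y => F (s, y)).
      exact: measurableT_comp mF (pair1_measurable s).
    move=> /(@measurable_funTS _ _ _ _ B) h; apply/measurable_EFinP.
    apply: eq_measurable_fun h => y yB; rewrite FE yB andbT mem_set//.
  by move=> l Bl; exact: fab.
have if2 l : B l -> m1.-integrable A (EFin \o f ^~ l).
  move=> Bl; apply: (dominated_integrableR mA _ (integrableRZ (b l) mA ia)).
    have h := @measurable_funTS _ _ _ _ A _ (measurable_fun_pair1 l mF).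
    apply/measurable_EFinP.
    by apply: eq_measurable_fun h => x xA; rewrite FE xA/= mem_set.
  by move=> s As; rewrite mulrC; exact: fab.
have F1 s : (\int[m2]_y F (s, y) = (((fun s => \int[m2]_(l in B) f s l) \_ A) s)%:E)%E.
  rewrite patchE; case: ifPn => sA; last first.
    by rewrite integral0_eq// => y _; rewrite FE (negbTE sA).
  rewrite /Rintegral fineK; last by apply: integrable_fin_num => //; exact/if1/set_mem.
  rewrite [RHS]integral_mkcond; apply: eq_integral => y _.
  by rewrite FE sA/= patchE; case: ifPn.
have F2 l : (\int[m1]_x F (x, l) = (((fun l => \int[m1]_(s in A) f s l) \_ B) l)%:E)%E.
  rewrite patchE; case: ifPn => lB; last first.
    by rewrite integral0_eq// => y _; rewrite FE (negbTE lB) andbF.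
  rewrite /Rintegral fineK; last by apply: integrable_fin_num => //; exact/if2/set_mem.
  rewrite [RHS]integral_mkcond; apply: eq_integral => y _.
  by rewrite FE lB andbT patchE; case: ifPn.
pose Ib := \int[m2]_(y in B) `|b y|.
have ib' : m2.-integrable B (EFin \o (fun y => `|b y|)) by exact: (integrable_abse ib).
pose ga x := Ib * `|a x|.
have iga : m1.-integrable setT (EFin \o (ga \_ A)).
  rewrite -restrict_EFin; apply/(integrable_mkcond _ mA).
  by apply: integrableRZ => //; exact: (integrable_abse ia).
have ga0 x : 0 <= (ga \_ A) x.
  rewrite patchE; case: ifP => // _; rewrite mulr_ge0//.
  by apply: Rintegral_ge0.
have iF : (m1 \x m2)%E.-integrable setT F.
  apply/integrable12ltyP => //.
  apply: (@le_lt_trans _ _ (\int[m1]_x `|((ga \_ A) x)%:E|)%E); last first.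
    by case/integrableP : iga.
  apply: ge0_le_integral => //.
  - by move=> x _; exact: integral_ge0.
  - apply: (@measurable_fun_fubini_tonelli_F _ _ _ _ _ m2 (abse \o F)) => //.
      exact: measurableT_comp.
    by move=> x; exact: abse_ge0.
  - by apply: measurableT_comp => //; case/integrableP : iga.
  - move=> x _; rewrite gee0_abs ?lee_fin// patchE.
    case: ifPn => xA; last first.
      by rewrite integral0_eq// => y _; rewrite FE (negbTE xA) abse0.
    have Ax := set_mem xA.
    rewrite /ga mulrC -RintegralZl// /Rintegral fineK; last first.
      apply: integrable_fin_num => //.
      exact: (integrableRZ `|a x| mB ib').
    rewrite [leRHS]integral_mkcond; apply: ge0_le_integral => //.
    + apply: measurableT_comp => //.
      exact: measurableT_comp mF (pair1_measurable x).
    + apply/(measurable_restrictT _ mB).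
      by case/integrableP : (integrableRZ `|a x| mB ib').
    + move=> y _; rewrite FE xA/= patchE; case: ifPn => yB; last by rewrite /= normr0.
      rewrite lee_fin (le_trans (fab _ _ Ax (set_mem yB)))//.
      by rewrite -normrM ler_norm.
split.
  apply: (integrable_mkcond _ mA).2; rewrite restrict_EFin.
  have := integrable_fubini_F iF; rewrite /fubini_F.
  by apply: eq_integrable => // s _; rewrite F1.
have := Fubini iF.
rewrite (eq_integral (fun s => (((fun s => \int[m2]_(l in B) f s l) \_ A) s)%:E)) => [|s _]//.
rewrite [in X in _ = X -> _](eq_integral (fun l => (((fun l => \int[m1]_(s in A) f s l) \_ B) l)%:E)) => [|s _]//.
move=> h; rewrite [LHS]Rintegral_mkcond [RHS]Rintegral_mkcond.
exact: (congr1 fine h).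
Qed.

End real_Fubini.

Section Mellin_interchange.
Context {R : realType}.
Notation mu := (@lebesgue_measure R).
Notation posR := [set` (`]0, +oo[ : interval R)].
Variables (a b C g p : R) (h : R -> R).
Hypotheses (a0 : 0 < a) (b0 : 0 < b) (C0 : 0 <= C) (g1 : -1 < g) (p0 : 0 < p)
  (mh : measurable_fun posR h)
  (hC : forall l, 0 < l -> `|h l| <= C * l `^ b).

Let mP : measurable (posR : set (measurableTypeR R)).
Proof. exact: measurable_itv. Qed.

Let Nb0 : - b < 0. Proof. by rewrite oppr_lt0. Qed.

(** Fubini.  For [s] between [0] and [p] the kernel is under the envelope of
    exponents [b + 0] and [b + p]; the first is positive because [0 < b]. *)
Lemma frac_int_Mellin (phi : R -> R) k : cont_right (- b) phi ->
  mu.-integrable posR (EFin \o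
    (fun l => h l * frac_int g (fun s => phi s * gamma_kernel a l k s) p)) /\
  \int[mu]_(l in posR)
    (h l * frac_int g (fun s => phi s * gamma_kernel a l k s) p) =
  frac_int g (fun s => phi s * Mellin a h k s) p.
Proof.
move=> cphi; have [B B0 hB] := cont_right_bounded p Nb0 cphi.
have e1 : 0 < b + 0 by rewrite addr0.
have e2 : 0 < b + p by rewrite addr_gt0.
pose f l s := h l * ((p - s) `^ g * (phi s * gamma_kernel a l k s)).
have mS : measurable (posR `*` [set` `]0, p[] : set (R * R)) by exact: measurableX.
have [||||i1 i2] := @Rfubini _ _ _ _ R mu mu posR [set` `]0, p[] f
    (fun l => C * envelope a k (b + 0) (b + p) l) (fun s => B * (p - s) `^ g)
    (measurable_itv _) (measurable_itv _).
- apply: (@eq_measurable_fun _ _ _ _ _ (fun x : R * R => h x.1 * ((p - x.2) `^ g *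
    (phi x.2 * (ln x.1 ^+ k * expR ((x.2 - 1) * ln x.1) * expR (- (a * x.1))))))).
    move=> [l s]; rewrite inE/= !in_itv/= andbT => -[l0 _].
    by rewrite /f /gamma_kernel /powR (gt_eqF l0).
  have m1 (u : R -> R) : measurable_fun posR u ->
      measurable_fun (posR `*` [set` `]0, p[]) (fun x : R * R => u x.1).
    move=> mu1; apply: (measurable_comp (F := posR)) => //.
    - by move=> y [[l s] [/= l0 _] <-].
    - exact: measurable_funTS.
  have m2 (u : R -> R) : measurable_fun [set` `]0, p[] u ->
      measurable_fun (posR `*` [set` `]0, p[]) (fun x : R * R => u x.2).
    move=> mu1; apply: (measurable_comp (F := [set` `]0, p[])) => //.
    - by move=> y [[l s] [/= _ s0] <-].
    - exact: measurable_funTS.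
  apply: measurable_funM; first exact: m1.
  apply: measurable_funM.
    by apply: (m2 (fun s => (p - s) `^ g)); exact: measurable_powR_sub.
  apply: measurable_funM; first by apply: m2; exact: cont_right_measurable cphi.
  apply: measurable_funM; last first.
    by apply: (m1 (fun l => expR (- (a * l)))); exact: measurable_expRN.
  apply: measurable_funM.
    by apply: (m1 (fun l => ln l ^+ k)); exact: measurable_lnX.
  apply: measurableT_comp; first exact: measurable_expR.
  apply: measurable_funM.
    by apply: (m2 (fun s => s - 1)); exact: measurable_funB.
  by apply: m1; apply: measurable_funTS; exact: measurable_ln.
- by apply: integrableRZ => //; exact: integrable_envelope.
- by apply: integrableRZ => //; exact: integrable_powR_sub.
- move=> l s; rewrite /= !in_itv/= andbT => l0 /andP[s0 sp].
  have -> : f l s = (h l * gamma_kernel a l k s) * (phi s * (p - s) `^ g).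
    by rewrite /f; ring.
  rewrite normrM ler_pM//.
    by apply: Mellin_dominated => //; rewrite !ltW.
  by rewrite normrM (ger0_norm (powR_ge0 _ _)) ler_wpM2r ?powR_ge0// hB// !ltW.
have E l : 0 < l -> \int[mu]_(s in `]0, p[) f l s =
    h l * frac_int g (fun s => phi s * gamma_kernel a l k s) p.
  move=> l0; apply: RintegralZl; first exact: measurable_itv.
  have ck : cont_right (- b) (fun s => phi s * gamma_kernel a l k s).
    move=> x bx; apply: cvgM; first exact: cphi.
    exact: (dseq_continuous (x0 := - b) (dseq_gamma_kernel _ l0)).
  exact: (integrable_frac_int g1 Nb0 ck p0).
split.
  by apply: (eq_integrableR mP _ i1) => l; rewrite /= in_itv/= andbT => l0; rewrite E.
transitivity (\int[mu]_(l in posR) \int[mu]_(s in `]0, p[) f l s).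
  by apply: eq_Rintegral => l; rewrite inE/= in_itv/= andbT => l0; rewrite E.
rewrite i2; apply: eq_Rintegral => s; rewrite inE/= in_itv/= => /andP[s0 sp].
rewrite mulrA /Mellin -RintegralZl; first last.
- by apply: (integrable_Mellin a0 C0 mh hC k); exact: lt_trans s0.
- exact: measurable_itv.
by apply: eq_Rintegral => l _; rewrite /f; ring.
Qed.

Let shiftk (u : nat -> R -> R) k :
  shift_seq (fun i => u (k + i)%N) = (fun i => u (k.+1 + i)%N).
Proof. by apply/funext => i; rewrite /shift_seq addnS. Qed.

Let dseqk z (u : nat -> R -> R) k : dseq z u -> dseq z (fun i => u (k + i)%N).
Proof. by move=> du j x zx; rewrite addnS; exact: du. Qed.

(** Induction on [m]: one derivative turns the product of [c] and the kernel
    into two products of the same shape, with [c'] or with one more logarithm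
    (whence the shift [k]), and leaves a boundary term that is a Mellin
    integral.  The case [m = 0] is Fubini. *)
Lemma frac_deriv_Mellin m c k : dseq (- b) c ->
  mu.-integrable posR (EFin \o (fun l =>
    h l * frac_deriv g (Leibniz c (fun i => gamma_kernel a l (k + i)%N)) m p)) /\
  \int[mu]_(l in posR)
    (h l * frac_deriv g (Leibniz c (fun i => gamma_kernel a l (k + i)%N)) m p) =
  frac_deriv g (Leibniz c (fun i => Mellin a h (k + i)%N)) m p.
Proof.
elim: m c k => [|m ih] c k dc /=.
  by rewrite addn0; exact: frac_int_Mellin (dseq_cont_right (j := 0) dc).
have dM : dseq (- b) (fun i => Mellin a h (k + i)%N).
  exact/dseqk/(dseq_Mellin a0 C0 mh hC).
have [i1 e1] := ih _ k (dseq_shift dc).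
have [i2 e2] := ih c k.+1 dc.
have i3 := integrable_Mellin a0 C0 mh hC k Nb0.
pose K := c 0 0 * powR_deriv g m p.
have i12 := integrableRD mP i1 i2.
have i123 := integrableRD mP i12 (integrableRZ K mP i3).
have E l : 0 < l ->
  h l * frac_deriv g (Leibniz (shift_seq c) (fun i => gamma_kernel a l (k + i)%N)) m p +
  h l * frac_deriv g (Leibniz c (fun i => gamma_kernel a l (k.+1 + i)%N)) m p +
  K * (h l * gamma_kernel a l k 0) =
  h l * (frac_deriv g (shift_seq (Leibniz c (fun i => gamma_kernel a l (k + i)%N))) m p +
    c 0 0 * gamma_kernel a l k 0 * powR_deriv g m p).
  move=> l0; rewrite (frac_deriv_Leibniz m g1 Nb0 dc _ p0); last first.
    exact/dseqk/dseq_gamma_kernel.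
  by rewrite shiftk /K; ring.
split.
  by apply: (eq_integrableR mP _ i123) => l; rewrite /= in_itv/= andbT => l0;
    rewrite E// addn0.
rewrite (frac_deriv_Leibniz m g1 Nb0 dc dM p0) shiftk -e1 -e2 addn0.
rewrite [Mellin a h k 0]/Mellin.
have -> : c 0 0 * (\int[mu]_(l in posR) (h l * gamma_kernel a l k 0)) * powR_deriv g m p =
    \int[mu]_(l in posR) (K * (h l * gamma_kernel a l k 0)).
  by rewrite RintegralZl// /K mulrAC.
rewrite -!RintegralD//; last exact: integrableRZ.
by apply: eq_Rintegral => l; rewrite inE/= in_itv/= andbT => l0; rewrite -E.
Qed.

End Mellin_interchange.


(** * The law of the subordinated and mixed Poisson variables *)

Section product_laws.
Context d d1 d2 d3 (T : measurableType d) (T1 : measurableType d1)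
  (T2 : measurableType d2) (T3 : measurableType d3) {R : realType}
  (P : probability T R).

Lemma rectangle_measure_unique (m m' : {measure set (T1 * T2) -> \bar R}) :
  (m setT < +oo)%E ->
  (forall A B, measurable A -> measurable B -> m (A `*` B) = m' (A `*` B)) ->
  forall E, measurable E -> m E = m' E.
Proof.
move=> moo mm'; apply: (measure_unique
  [set A `*` B | A in measurable & B in measurable] (fun=> setT)).
- exact: measurable_prod_measurableType.
- move=> _ _ [A mA [B mB <-]] [A' mA' [B' mB' <-]].
  exists (A `&` A'); first exact: measurableI.
  exists (B `&` B'); first exact: measurableI.
  by rewrite setXI.
- by move=> _; exists setT => //; exists setT => //; rewrite setXTT.
- by rewrite bigcup_const.
- by move=> _ [A mA [B mB <-]]; exact: mm'.
- by [].
Qed.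

Lemma measurable_mfun_preimage d' (T' : measurableType d') (X : {mfun T >-> T'}) A :
  measurable A -> measurable (X @^-1` A).
Proof. by move=> mA; rewrite -[X in measurable X]setTI; exact: measurable_funP. Qed.

Let measurable_pair_mfun (X : {mfun T >-> T1}) (Y : {mfun T >-> T2}) :
  measurable_fun setT (fun w => (X w, Y w)).
Proof. exact: measurable_fun_pair. Qed.

Definition mfun_pair (X : {mfun T >-> T1}) (Y : {mfun T >-> T2}) :
  {mfun T >-> (T1 * T2)%type} := mfun_Sub (mem_set (measurable_pair_mfun X Y)).

Lemma independent_pair_law (X : {mfun T >-> T1}) (Y : {mfun T >-> T2}) :
  (forall A B, measurable A -> measurable B ->
    P (X @^-1` A `&` Y @^-1` B) = (P (X @^-1` A) * P (Y @^-1` B))%E) ->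
  forall E, measurable E ->
    P [set w | E (X w, Y w)] = (distribution P X \x distribution P Y)%E E.
Proof.
move=> indep E mE.
have := @product_measure_unique _ _ _ _ _ (distribution P X) (distribution P Y)
  (distribution P (mfun_pair X Y)).
by move=> ->.
Qed.

(** For fixed [C] both sides are finite measures of [E], and the independence of
    the three variables says that they agree on rectangles. *)
Lemma independent_pair (X : {mfun T >-> T1}) (Y : {mfun T >-> T2})
    (Z : {mfun T >-> T3}) :
  (forall A B C, measurable A -> measurable B -> measurable C ->
    P (X @^-1` A `&` Y @^-1` B `&` Z @^-1` C) =
    (P (X @^-1` A) * P (Y @^-1` B) * P (Z @^-1` C))%E) ->
  forall C E, measurable C -> measurable E ->
    P (Z @^-1` C `&` mfun_pair X Y @^-1` E) =
    (P (Z @^-1` C) * P (mfun_pair X Y @^-1` E))%E.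
Proof.
move=> indep C E mC mE; have mZC := measurable_mfun_preimage Z mC.
have PZ0 : 0 <= fine (P (Z @^-1` C)) by exact: fine_ge0.
have PZE : (fine (P (Z @^-1` C)))%:E = P (Z @^-1` C).
  by rewrite fineK// fin_num_measure.
rewrite setIC.
transitivity (mscale (NngNum PZ0) (distribution P (mfun_pair X Y)) E); last first.
  by rewrite /mscale/= PZE.
apply: (@rectangle_measure_unique
  (pushforward (mrestr P mZC) (mfun_pair X Y)) _ _ _ _ mE) => //.
  apply: (@le_lt_trans _ _ 1%E); last exact: ltry.
  apply: (@probability_le1 _ _ _ P (mfun_pair X Y @^-1` setT `&` Z @^-1` C)).
  by apply: measurableI => //; rewrite preimage_setT.
move=> A B mA mB.
have e1 : P (X @^-1` A `&` Y @^-1` B) = (P (X @^-1` A) * P (Y @^-1` B))%E.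
  have := indep A B setT mA mB measurableT.
  by rewrite preimage_setT setIT probability_setT mule1.
transitivity (P (X @^-1` A `&` Y @^-1` B `&` Z @^-1` C)); first by [].
transitivity ((fine (P (Z @^-1` C)))%:E * P (X @^-1` A `&` Y @^-1` B))%E; last by [].
by rewrite PZE e1 indep// muleC.
Qed.

Lemma ae_eq_event (A B : set T) : measurable A -> measurable B ->
  {ae P, forall w, A w <-> B w} -> P A = P B.
Proof.
move=> mA mB [M [mM M0 hM]].
have sub (U V : set T) : measurable U -> measurable V ->
    (forall w, ~ M w -> U w -> V w) -> (P U <= P V)%E.
  move=> mU mV UV; apply: (@le_trans _ _ (P (V `|` M))).
    apply: le_measure; rewrite ?inE//; first exact: measurableU.
    by move=> w Uw; have [Mw|nMw] := pselect (M w); [right|left; exact: UV Uw].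
  apply: (@le_trans _ _ (P V + P M)%E); first exact: measureU2.
  by rewrite [X in (_ + X)%E]M0 adde0.
have key w : ~ M w -> (A w <-> B w).
  by move=> nMw; apply: contrapT => h; apply: nMw; exact: hM.
by apply/eqP; rewrite eq_le; apply/andP; split; apply: sub => // w /key [].
Qed.

End product_laws.

Section subordinated_Poisson.
Context {R : realType} d (T : measurableType d) (P : probability T R).
Notation mu := (@lebesgue_measure R).
Notation posR := [set` (`]0, +oo[ : interval R)].
Variables (beta alpha t : R) (n : nat)
  (D : R -> {RV P >-> R}) (N : R -> R -> {RV P >-> nat})
  (Gam : R -> {RV P >-> R}).
Hypotheses (ht : 0 <= t)
  (hD : stable_subordinator beta D)
  (hN : forall lambda : R, 0 < lambda ->
          poisson_process lambda (fun s => N s lambda))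
  (hNm : jointly_measurable_field N)
  (hGam : forall p : R, 0 < p -> gamma_distributed alpha p (Gam p))
  (hind : forall p : R, 0 < p ->
     independent3 P
       (family_generators [set s : R | 0 <= s] (fun s => D s : T -> R))
       (N_generators N)
       (family_generators [set p] (fun q => Gam q : T -> R))).

(** The sample space with the sigma-algebra of the Poisson field only, so that
    the identity is a random variable independent of [D] and of [Gam]. *)
Notation TN := (g_sigma_algebraType (N_generators N)).

Let measurable_id_TN : measurable_fun setT (fun w : T => w : TN).
Proof.
apply: (@measurability _ _ _ _ setT (fun w : T => w : TN) (N_generators N)) => //.
move=> _ [B [x _ [A mA <-]] <-]; rewrite !setTI.
exact: (measurable_mfun_preimage (N x.1 x.2)).
Qed.

Definition id_TN : {mfun T >-> TN} := mfun_Sub (mem_set measurable_id_TN).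

Let independence p A B C : 0 < p -> measurable A -> measurable (B : set TN) ->
  measurable C ->
  P (D t @^-1` A `&` id_TN @^-1` B `&` Gam p @^-1` C) =
  (P (D t @^-1` A) * P (id_TN @^-1` B) * P (Gam p @^-1` C))%E.
Proof.
move=> p0 mA mB mC; apply: (hind p0).
- by apply: sub_sigma_algebra; exists t => //; exists A => //; rewrite setTI.
- exact: mB.
- by apply: sub_sigma_algebra; exists p => //; exists C => //; rewrite setTI.
Qed.

Let DW : {mfun T >-> (R * TN)%type} := mfun_pair (D t) id_TN.

Let muD := distribution P (D t).
Let muN := distribution P id_TN.

Let law_DW (E : set (R * TN)) : measurable E ->
  P [set w | E (D t w, w)] = (muD \x muN)%E E.
Proof.
apply: (@independent_pair_law _ _ _ _ _ _ _ P (D t) id_TN) => A B mA mB.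
have := independence ltr01 mA mB measurableT.
by rewrite preimage_setT setIT probability_setT mule1.
Qed.

Let law_GDW p (E : set (R * (R * TN))) : 0 < p -> measurable E ->
  P [set w | E (Gam p w, (D t w, w))] =
  (distribution P (Gam p) \x distribution P DW)%E E.
Proof.
move=> p0; apply: (@independent_pair_law _ _ _ _ _ _ _ P (Gam p) DW) => A B mA mB.
apply: independent_pair => // A' B' C' mA' mB' mC'.
exact: independence.
Qed.

Let E_ (k : nat) : set (R * (R * TN)) := [set z | N z.2.1 z.1 z.2.2 = k].

Let mE k : measurable (E_ k).
Proof.
have m1 : measurable_fun setT (fun z : R * (R * TN) => ((z.2.1, z.1), z.2.2)).
  apply: measurable_fun_pair; last exact: measurableT_comp.
  by apply: measurable_fun_pair => //; exact: measurableT_comp.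
have := measurableT_comp hNm m1 => /(_ measurableT [set k]).
by rewrite setTI; apply.
Qed.

Local Notation ptilde l := (pmf_at P (sf_poisson D N t l) n).

Let ptilde_section k l : P [set w | sf_poisson D N t l w = k] =
  distribution P DW (xsection (E_ k) l).
Proof.
rewrite /distribution /pushforward; congr (P _); apply/seteqP; split => w /=;
  by rewrite xsectionE.
Qed.

Lemma measurable_sf_poisson_event k l : measurable [set w | sf_poisson D N t l w = k].
Proof.
have := measurable_mfun_preimage DW (measurable_xsection l (mE k)).
by congr measurable; apply/seteqP; split => w /=; rewrite xsectionE.
Qed.

Lemma sf_poisson_pmf_ge0 l : 0 <= ptilde l. Proof. exact: fine_ge0. Qed.

Let ptildeE l : (ptilde l)%:E = P [set w | sf_poisson D N t l w = n].
Proof. by rewrite /pmf_at fineK// fin_num_measure//; exact: measurable_sf_poisson_event. Qed.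

Lemma sf_poisson_pmf_le1 l : ptilde l <= 1.
Proof. by rewrite -lee_fin ptildeE probability_le1//; exact: measurable_sf_poisson_event. Qed.

Lemma measurable_sf_poisson_pmf : measurable_fun setT (fun l => ptilde l).
Proof.
apply/measurable_EFinP.
have := measurable_fun_xsection (distribution P DW) (mE n).
by apply: eq_measurable_fun => l _; rewrite /= -ptilde_section ptildeE.
Qed.

Lemma gamma_density_ge0 y p : 0 <= gamma_density y alpha p.
Proof.
rewrite /gamma_density; case: ifPn => // /andP[_ p0].
by rewrite !mulr_ge0 ?powR_ge0 ?expR_ge0// invr_ge0 ltW// Gamma_fun_gt0.
Qed.

Lemma measurable_gamma_density p :
  measurable_fun setT (fun y => gamma_density y alpha p).
Proof.
have [p0|p0] := ltP 0 p; last first.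
  rewrite (_ : (fun y => _) = cst 0); first exact: measurable_cst.
  by apply/funext => y; rewrite /gamma_density (le_gtF p0) andbF.
rewrite (_ : (fun y => _) = (fun y => alpha `^ p / Gamma_fun p * y `^ (p - 1) *
    expR (- (alpha * y))) \_ posR).
  apply/(measurable_restrictT _ (measurable_itv _)).
  apply: measurable_funM; last exact: measurable_expRN.
  by apply: measurable_funM => //; apply: measurable_funTS; exact: measurable_powR.
apply/funext => y; rewrite /gamma_density p0 andbT patchE.
by case: ifPn => y0; [rewrite mem_set//= in_itv/= andbT|
  rewrite memNset//= in_itv/= andbT; exact/negP].
Qed.

(** Mixing over the gamma law of the intensity.  The density is brought in by
    Tonelli: for a fixed outcome the gamma measure of a section of the event is
    an integral of the density by hypothesis. *)
Lemma sf_polya_mixture p : 0 < p ->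
  pmf_at P (sf_polya D N (Gam p) t) n =
  \int[mu]_(l in posR) (ptilde l * gamma_density l alpha p).
Proof.
move=> p0; pose nu := distribution P DW; pose E := E_ n.
pose g y := gamma_density y alpha p.
have g0 y : 0 <= g y by exact: gamma_density_ge0.
have mg : measurable_fun setT g by exact: measurable_gamma_density.
congr fine.
transitivity ((distribution P (Gam p) \x nu)%E E); first exact: (law_GDW p0 (mE n)).
have -> : (distribution P (Gam p) \x nu)%E E = (distribution P (Gam p) \x^ nu)%E E.
  apply: product_measure_unique; last exact: mE.
  by move=> A B mA mB; exact: product_measure2E.
pose f : R * (R * TN) -> \bar R := fun x => (g x.1 * \1_E x)%:E.
have mf : measurable_fun setT f.
  apply/measurable_EFinP; apply: measurable_funM.
    exact: measurableT_comp.
  by apply: measurable_indic; exact: mE.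
have f0 x : (0 <= f x)%E by rewrite lee_fin mulr_ge0.
transitivity (\int[nu]_z \int[mu]_y f (y, z))%E.
  apply: eq_integral => z _ /=.
  rewrite (hGam p0 (measurable_ysection z (mE n))).
  rewrite integral_mkcond; apply: eq_integral => y _.
  rewrite patchE /f/= indicE mem_ysection; case: ifPn => _; by rewrite ?mulr1 ?mulr0.
rewrite -(@fubini_tonelli _ _ _ _ _ mu nu f)//.
rewrite [RHS]integral_mkcond; apply: eq_integral => y _.
transitivity (\int[nu]_z ((g y)%:E * (\1_(xsection E y) z)%:E))%E.
  apply: eq_integral => z _; rewrite /f/= EFinM; congr (_ * _%:E)%E.
  by rewrite !indicE mem_xsection.
rewrite ge0_integralZl//; last 2 first.
- by apply/measurable_EFinP; apply: measurable_indic; exact: (measurable_xsection y (mE n)).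
- by rewrite lee_fin.
rewrite integral_indic//; last exact: (measurable_xsection y (mE n)).
rewrite setIT.
transitivity ((g y)%:E * (ptilde y)%:E)%E; first by rewrite ptildeE ptilde_section.
rewrite -EFinM mulrC patchE.
case: ifPn => // yN; rewrite /g /gamma_density ifF ?mulr0//.
by apply: contraNF yN => /andP[y0 _]; rewrite inE/= in_itv/= y0.
Qed.

Lemma gamma_density_mass p : 0 < p ->
  \int[mu]_(l in posR) gamma_density l alpha p = 1.
Proof.
move=> p0; have h := hGam p0 measurableT.
rewrite -[RHS]/(fine 1%E) -(probability_setT (distribution P (Gam p))).
congr fine; rewrite [RHS]h [LHS]integral_mkcond; apply: eq_integral => y _.
rewrite patchE; case: ifPn => // yN; rewrite /gamma_density ifF//.
by apply: contraNF yN => /andP[y0 _]; rewrite inE/= in_itv/= y0.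
Qed.

(** The law of [N s l] is only given for [0 <= s]. *)
Let muD_ge0 : {ae P, forall w, 0 <= D t w}.
Proof.
case: hD => D0 _ _ paths _; near=> w.
have h0 : D 0 w = 0 by near: w.
have [h1 _] : (forall s t : R, 0 <= s -> s <= t -> D s w <= D t w) /\
    (forall t : R, 0 <= t -> D s w @[s --> t^'+] --> D t w) by near: w.
by rewrite -h0; apply: h1.
Unshelve. all: by end_near. Qed.

Let Poisson0 s l : 0 < l -> 0 <= s ->
  P [set w | N s l w = 0%N] = (expR (- l * s))%:E.
Proof.
move=> l0 s0; case: (hN l0) => N0 _ Npmf _.
have mNk r k : measurable [set w | N r l w = k].
  exact: (measurable_mfun_preimage (N r l) (A := [set k])).
have := s0; rewrite le_eqVlt => /predU1P[<-|s1].
  rewrite mulr0 expR0 -(@probability_setT _ _ _ P); apply: ae_eq_event => //.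
  by near=> w; split=> // _; near: w.
have := Npmf 0 s 0%N (lexx _) s1.
rewrite subr0 /poisson_pmf mulr_gt0// expr0 fact0 invr1 !mul1r mulNr => <-.
apply: ae_eq_event => //.
  rewrite (_ : [set w | _] = \bigcup_k ([set w | N s l w = k] `&` [set w | N 0 l w = k])).
    by apply: bigcupT_measurable => k; exact: measurableI.
  apply/seteqP; split => w /=.
    by rewrite addn0 => h; exists (N 0 l w).
  by move=> [k _ [/= -> ->]]; rewrite addn0.
near=> w; have h : N 0 l w = 0%N by near: w.
by rewrite /= h addn0.
Unshelve. all: by end_near. Qed.

(** Conditioning on [D t] turns the probability of no event into the Laplace
    transform of [D t]. *)
Lemma sf_poisson0 l : 0 < l ->
  P [set w | sf_poisson D N t l w = 0%N] = (expR (- t * l `^ beta))%:E.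
Proof.
move=> l0; have mX : measurable (xsection (E_ 0%N) l) by exact: measurable_xsection.
pose phi x := muN (xsection (xsection (E_ 0%N) l) x).
have mphi : measurable_fun setT phi by exact: measurable_fun_xsection.
have phiE x : 0 <= x -> phi x = (expR (- l * x))%:E.
  move=> x0; rewrite -Poisson0// /phi /muN /distribution /pushforward.
  by congr (P _); apply/seteqP; split => w /=; rewrite !xsectionE.
rewrite ptilde_section; transitivity ((muD \x muN)%E (xsection (E_ 0%N) l)).
  exact: (law_DW mX).
transitivity (\int[P]_w phi (D t w))%E.
  exact: (ge0_integral_distribution (D t) mphi).
case: hD => _ _ _ _ /(_ t l ht l0) <-; rewrite unlock.
apply: ge0_ae_eq_integral => //.
- exact: measurableT_comp.
- apply/measurable_EFinP; apply: measurableT_comp; first exact: measurable_expR.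
  by apply: measurable_funM.
near=> w => _; apply: phiE; near: w; exact: muD_ge0.
Unshelve. all: by end_near. Qed.

(** [1 + x <= expR x], here and in the next lemma; the power [l `^ beta] is what
    makes the Mellin transforms smooth at the origin. *)
Lemma sf_poisson_pmf0_lower l : n = 0%N -> 0 < l -> 1 - t * l `^ beta <= ptilde l.
Proof.
move=> n0 l0; rewrite -lee_fin ptildeE n0 sf_poisson0// lee_fin.
by rewrite -mulNr expR_ge1Dx.
Qed.

Lemma sf_poisson_pmfS_upper l : (0 < n)%N -> 0 < l -> ptilde l <= t * l `^ beta.
Proof.
move=> n0 l0; rewrite -lee_fin ptildeE.
have m0 := measurable_sf_poisson_event 0 l.
apply: (@le_trans _ _ (P (~` [set w | sf_poisson D N t l w = 0%N]))).
  apply: le_measure; rewrite ?inE; [exact: measurable_sf_poisson_event|exact: measurableC|].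
  by move=> w /= ->; case: n n0.
rewrite probability_setC// sf_poisson0// -EFinB lee_fin.
have := expR_ge1Dx (- t * l `^ beta); rewrite mulNr; lra.
Qed.

End subordinated_Poisson.

(** * The differential equation for gamma mixtures *)

Section mixture_equation.
Context {R : realType}.
Notation mu := (@lebesgue_measure R).
Notation posR := [set` (`]0, +oo[ : interval R)].
Variables (a b C : R) (h eta : R -> R).
Hypotheses (a0 : 0 < a) (b0 : 0 <= b) (b1 : b <= 1) (C0 : 0 <= C)
  (mh : measurable_fun posR h)
  (hC : forall l, 0 < l -> `|h l| <= C * l `^ b)
  (etaE : forall p, 0 < p ->
    eta p = \int[mu]_(l in posR) (h l * gamma_density l a p)).

Let mP : measurable (posR : set (measurableTypeR R)).
Proof. exact: measurable_itv. Qed.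

Let c := gamma_coef_seq a.
Let M := Mellin a h.

Let F (p : R) : R := (ln a - digamma p) * eta p.
Let K (nu p l : R) : R :=
  h l * ln l * RL_deriv nu (fun q => gamma_density l a q) p.

Let dc : dseq (- b) c.
Proof. by apply: dseq_le (dseq_gamma_coef a); rewrite lerN2. Qed.

Let dM : dseq (- b) M. Proof. exact: dseq_Mellin a0 C0 mh hC. Qed.

Let dL : dseq (- b) (Leibniz c M). Proof. exact: dseq_Leibniz. Qed.

Let dF : dseq (- b) (Leibniz (shift_seq c) M).
Proof. exact: (dseq_Leibniz (dseq_shift dc) dM). Qed.

Let dgk l : 0 < l -> dseq (- b) (Leibniz c (gamma_kernel a l)).
Proof. by move=> l0; apply: dseq_Leibniz => //; exact: dseq_gamma_kernel. Qed.

(** The gamma density is a factor in [p] alone times the Mellin kernel, hence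
    every derivative of [eta] is a derivative of a product. *)
Lemma mixture_Leibniz p : 0 < p -> eta p = Leibniz c M 0 p.
Proof.
move=> p0; rewrite etaE//= /M /Mellin -RintegralZl//.
  apply: eq_Rintegral => l; rewrite inE/= in_itv/= andbT => l0.
  by rewrite gamma_densityE// mulrCA.
by apply: (integrable_Mellin a0 C0 mh hC 0); rewrite (le_lt_trans _ p0)// oppr_le0.
Qed.

Let F_Leibniz p : 0 < p -> F p = Leibniz (shift_seq c) M 0 p.
Proof.
move=> p0; rewrite /F mixture_Leibniz//= mulrA; congr (_ * _).
by rewrite /shift_seq /c gamma_coef_seq1.
Qed.

Let density_Leibniz l p : 0 < l -> 0 < p ->
  gamma_density l a p = Leibniz c (gamma_kernel a l) 0 p.
Proof. by move=> l0 p0; rewrite gamma_densityE. Qed.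

(** One more logarithm is one more derivative of the kernel. *)
Let ln_Leibniz (e : nat -> R -> R) l k j x :
  ln l * Leibniz e (fun i => gamma_kernel a l (k + i)%N) j x =
  Leibniz e (fun i => gamma_kernel a l (k.+1 + i)%N) j x.
Proof.
elim: j e k => [|j ih] e k /=.
  by rewrite addSn /gamma_kernel exprS; ring.
have sh m : shift_seq (fun i => gamma_kernel a l (m + i)%N) =
    (fun i => gamma_kernel a l (m.+1 + i)%N).
  by apply/funext => i; rewrite /shift_seq addnS.
by rewrite mulrDr ih !sh ih.
Qed.

Let Leibniz_Mellin (e : nat -> R -> R) j k p : - b < p ->
  mu.-integrable posR
    (EFin \o (fun l => h l * Leibniz e (fun i => gamma_kernel a l (k + i)%N) j p)) /\
  \int[mu]_(l in posR) (h l * Leibniz e (fun i => gamma_kernel a l (k + i)%N) j p) =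
  Leibniz e (fun i => M (k + i)%N) j p.
Proof.
move=> bp; elim: j e k => [|j ih] e k.
  rewrite /= addn0; have i1 := integrable_Mellin a0 C0 mh hC k bp.
  have E l : h l * (e 0 p * gamma_kernel a l k p) = e 0 p * (h l * gamma_kernel a l k p).
    by rewrite mulrCA.
  split; first by apply: (eq_integrableR mP _ (integrableRZ (e 0 p) mP i1)).
  by rewrite /M /Mellin -RintegralZl//; apply: eq_Rintegral => l _; rewrite E.
have [i1 e1] := ih (shift_seq e) k; have [i2 e2] := ih e k.+1.
have sh (u : nat -> R -> R) : shift_seq (fun i => u (k + i)%N) = (fun i => u (k.+1 + i)%N).
  by apply/funext => i; rewrite /shift_seq addnS.
rewrite /= (sh M) -e1 -e2 -RintegralD//; split.
  apply: (eq_integrableR mP _ (integrableRD mP i1 i2)) => l _.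
  by rewrite (sh (gamma_kernel a l)) mulrDr.
by apply: eq_Rintegral => l _; rewrite (sh (gamma_kernel a l)) mulrDr.
Qed.

(** Ordinary derivatives at [p > 0] do not see the origin, so that [b = 0], that
    is a bounded [h], is enough. *)
Lemma mixture_equation_nat m p : 0 < p ->
  [/\ [/\ RL_exists (m%:R : R) F p,
        forall l, 0 < l -> RL_exists (m%:R : R) (fun q => gamma_density l a q) p &
        mu.-integrable posR (fun l => (K m%:R p l)%:E)],
      RL_exists (m.+1%:R : R) eta p &
      RL_deriv m.+1%:R eta p =
        RL_deriv m%:R F p + \int[mu]_(l in posR) K m%:R p l].
Proof.
move=> p0; have Nb : - b <= 0 by rewrite oppr_le0.
have bp : - b < p by exact: le_lt_trans p0.
have d0F := dseq_le Nb dF.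
have d0L := dseq_le Nb dL.
have [F1 F2] := RL_smooth_nat m d0F F_Leibniz p0.
have [E1 E2] := RL_smooth_nat m.+1 d0L mixture_Leibniz p0.
have G l : 0 < l -> RL_exists (m%:R : R) (fun q => gamma_density l a q) p /\
    RL_deriv m%:R (fun q => gamma_density l a q) p = Leibniz c (gamma_kernel a l) m p.
  move=> l0; apply: (RL_smooth_nat m (dseq_le Nb (dgk l0))) => //.
  by move=> s s0; exact: density_Leibniz.
have [i1 e1] := Leibniz_Mellin c m 1 bp.
have KE l : 0 < l -> h l * Leibniz c (fun i => gamma_kernel a l (1 + i)%N) m p = K m%:R p l.
  by move=> l0; rewrite /K (G _ l0).2 -(ln_Leibniz c l 0) mulrA.
have iK : mu.-integrable posR (fun l => (K m%:R p l)%:E).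
  by apply: (eq_integrableR mP _ i1) => l; rewrite /= in_itv/= andbT; exact: KE.
split; [split; [exact: F1|by move=> l l0; exact: (G _ l0).1|exact: iK]|exact: E1|].
rewrite E2 F2/=; congr (_ + _); rewrite -[LHS]e1.
by apply: eq_Rintegral => l; rewrite inE/= in_itv/= andbT => l0; rewrite -KE.
Qed.

(** Passing from order [nu - 1] to order [nu] differentiates under the
    fractional integral, which leaves the value of [eta] at the origin as a
    boundary term.  That value is [0] because [1 / Gamma] vanishes there. *)
Lemma mixture_equation_frac nu p : 0 < b -> 0 <= nu ->
  nu = 0 \/ nu != (Num.truncn nu)%:R -> 0 < p ->
  [/\ [/\ RL_exists (nu - 1) F p,
        forall l, 0 < l -> RL_exists (nu - 1) (fun q => gamma_density l a q) p &
        mu.-integrable posR (fun l => (K (nu - 1) p l)%:E)],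
      RL_exists nu eta p &
      RL_deriv nu eta p =
        RL_deriv (nu - 1) F p + \int[mu]_(l in posR) K (nu - 1) p l].
Proof.
move=> bpos nu0 nuZ p0; have Nb : - b < 0 by rewrite oppr_lt0.
set w := nu - 1.
have wZ := nonint_pred nuZ; rewrite -/w in wZ.
have g1 := RL_exponent_gt w.
have [F1 F2] := RL_smooth wZ Nb dF F_Leibniz p0.
have G l : 0 < l -> RL_exists w (fun q => gamma_density l a q) p /\
    RL_deriv w (fun q => gamma_density l a q) p =
    (Gamma_fun ((RL_order w)%:R - w))^-1 *
    frac_deriv (RL_exponent w) (Leibniz c (gamma_kernel a l)) (RL_order w) p.
  move=> l0; apply: (RL_smooth wZ Nb (dgk l0)) => //.
  by move=> s s0; exact: density_Leibniz.
have [i1 e1] := frac_deriv_Mellin a0 bpos C0 g1 p0 mh hC (RL_order w) 1 dc.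
set ga := (Gamma_fun _)^-1 in F2 G.
have KE l : 0 < l -> ga * (h l * frac_deriv (RL_exponent w)
    (Leibniz c (fun i => gamma_kernel a l (1 + i)%N)) (RL_order w) p) = K w p l.
  move=> l0; rewrite /K (G _ l0).2.
  have -> : Leibniz c (fun i => gamma_kernel a l (1 + i)%N) =
      (fun j x => ln l * Leibniz c (gamma_kernel a l) j x).
    by apply/funext => j; apply/funext => x; rewrite -(ln_Leibniz c l 0).
  by rewrite (frac_derivZ _ _ g1 Nb (dgk l0) p0); ring.
have iK : mu.-integrable posR (EFin \o K w p).
  by apply: (eq_integrableR mP _ (integrableRZ ga mP i1)) => l;
    rewrite /= in_itv/= andbT; exact: KE.
have intK : \int[mu]_(l in posR) K w p l =
    ga * frac_deriv (RL_exponent w) (Leibniz c (shift_seq M)) (RL_order w) p.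
  rewrite -[frac_deriv _ _ _ _]e1 -RintegralZl//.
  by apply: eq_Rintegral => l; rewrite inE/= in_itv/= andbT => l0; rewrite -KE.
(* the product rule for eta = c * M, under the fractional derivative *)
have FM := frac_deriv_Leibniz (RL_order w) g1 Nb dc dM p0.
have eta00 : Leibniz c M 0 0 = 0 by rewrite /= /c /gamma_coef_seq/= gamma_coef_00 mul0r.
rewrite F2 intK -mulrDr -FM.
have [nu00|nun0] := eqVneq nu 0.
  (* the derivative of order 0 is the identity and that of order -1 an integral *)
  have w0 : w = -1 by rewrite /w nu00 sub0r.
  have o0 : RL_order w = 0%N by rewrite w0 /RL_order ltrN10.
  have x0 : RL_exponent w = 0 by rewrite /RL_exponent o0 w0; ring.
  have ga1 : ga = 1 by rewrite /ga o0 w0 sub0r opprK Gamma_fun1 invr1.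
  split; [split; [exact: F1|by move=> l l0; exact: (G _ l0).1|exact: iK]| |].
    by rewrite nu00 /RL_exists ltxx -[X in Num.truncn X]/(0%:R) natrK eqxx.
  rewrite nu00 /RL_deriv ltxx -[X in Num.truncn X]/(0%:R) natrK eqxx.
  rewrite [LHS]/= mixture_Leibniz// o0 x0 ga1 mul1r.
  rewrite [RHS](frac_int_derivative Nb dL p0).
  by rewrite [X in _ = _ - X]eta00 subr0.
have {}nuZ : nu < 0 \/ nu != (Num.truncn nu)%:R.
  by case: nuZ => [nu00|]; [rewrite nu00 eqxx in nun0|right].
have [E1 E2] := RL_smooth nuZ Nb dL mixture_Leibniz p0.
split; [split; [exact: F1|by move=> l l0; exact: (G _ l0).1|exact: iK]|exact: E1|].
have ox : RL_exponent nu = RL_exponent w.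
  by rewrite /RL_exponent (RL_order_succ nu0) -natr1 /w; ring.
rewrite E2 ox (RL_order_succ nu0) -/w.
have -> : (RL_order w).+1%:R - nu = (RL_order w)%:R - w by rewrite -natr1 /w; ring.
rewrite -/ga; congr (_ * _) => /=.
by rewrite -[X in _ + X * _]/(Leibniz c M 0 0) eta00 mul0r addr0.
Qed.

End mixture_equation.

(** * Failure of the right-hand side at zero events *)

Section mixture_singular.
Context {R : realType}.
Notation mu := (@lebesgue_measure R).
Notation posR := [set` (`]0, +oo[ : interval R)].
Variables (a b C : R) (h eta : R -> R).
Hypotheses (a0 : 0 < a) (b0 : 0 < b) (C0 : 0 <= C)
  (mh : measurable_fun posR h)
  (h1 : forall l, 0 < l -> `|h l| <= 1)
  (hC : forall l, 0 < l -> `|1 - h l| <= C * l `^ b)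
  (density1 : forall p, 0 < p -> \int[mu]_(l in posR) gamma_density l a p = 1)
  (etaE : forall p, 0 < p ->
    eta p = \int[mu]_(l in posR) (h l * gamma_density l a p)).

Let mP : measurable (posR : set (measurableTypeR R)).
Proof. exact: measurable_itv. Qed.

Let m1h : measurable_fun posR (fun l => 1 - h l).
Proof. by apply: measurable_funB => //; exact: measurable_cst. Qed.

Let Nb : - b < 0. Proof. by rewrite oppr_lt0. Qed.

Let dc : dseq (-1) (gamma_coef_seq a). Proof. exact: dseq_gamma_coef. Qed.

Let dM : dseq (- b) (Mellin a (fun l => 1 - h l)).
Proof. exact: dseq_Mellin a0 C0 m1h hC. Qed.

Let rest (p : R) : R := gamma_coef a p * Mellin a (fun l => 1 - h l) 0 p.

(** The density has mass [1], and [1 - h] vanishes at the origin, so that its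
    Mellin transform is finite there. *)
Lemma mixture_complement p : 0 < p -> eta p = 1 - rest p.
Proof.
move=> p0.
have bp : - b < p := lt_trans Nb p0.
have p0' : - 0 < p by rewrite oppr0.
have h1' l : 0 < l -> `|h l| <= 1 * l `^ 0.
  by move=> l0; rewrite powRr0 mulr1; exact: h1.
have i1 := integrable_Mellin a0 ler01 mh h1' 0 p0'.
have i2 := integrable_Mellin a0 C0 m1h hC 0 bp.
have j1 := integrableRZ (gamma_coef a p) mP i1.
have j2 := integrableRZ (gamma_coef a p) mP i2.
have e1 : eta p = \int[mu]_(l in posR) (gamma_coef a p * (h l * gamma_kernel a l 0 p)).
  rewrite etaE//; apply: eq_Rintegral => l; rewrite inE/= in_itv/= andbT => l0.
  by rewrite gamma_densityE// mulrCA.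
have e2 : rest p =
    \int[mu]_(l in posR) (gamma_coef a p * ((1 - h l) * gamma_kernel a l 0 p)).
  by rewrite /rest /Mellin -RintegralZl.
apply/eqP; rewrite eq_sym subr_eq; apply/eqP; rewrite e1 e2 -RintegralD//.
apply: (etrans (esym (density1 p0))); apply: eq_Rintegral => l.
rewrite inE/= in_itv/= andbT => l0.
by rewrite gamma_densityE//; ring.
Qed.

Let near0 (f : R -> R) (P : R -> Prop) : {for 0, continuous f} ->
  nbhs (f 0) P -> \forall s \near (0 : R), P (f s).
Proof. by move=> cf; exact: cf. Qed.

(** At the origin [- digamma s] behaves like [1 / s] and [eta] tends to [1], so
    that their product is not integrable. *)
Lemma mixture_singular nu p : -1 <= nu ->
  nu < 0 \/ nu != (Num.truncn nu)%:R -> 0 < p ->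
  ~ RL_exists nu (fun s => (ln a - digamma s) * eta s) p.
Proof.
move=> nu1 nuZ p0.
have N1 : -1 < (0 : R) by rewrite oppr_lt0.
have n1 : \forall s \near (0 : R), 2^-1 < gamma_coef_seq a 1 s.
  apply: (near0 (f := gamma_coef_seq a 1) (P := fun y => 2^-1 < y)).
    exact: dseq_continuous dc N1.
  by rewrite gamma_coef_seq1_0; apply: near_gt; lra.
have cc0 : {for 0, continuous (gamma_coef0 a)}.
  have [f' df _] := diff_on_gamma_coef0 a 1.
  by apply/differentiable_continuous/derivable1_diffP; case: (df 0 N1).
have n2 : \forall s \near (0 : R), gamma_coef0 a s < 2.
  apply: (near0 (P := fun y => y < 2) cc0).
  by rewrite gamma_coef0_0; apply: lt_nbhsl; lra.
have n3 : \forall s \near (0 : R), rest s < 2^-1.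
  apply: (near0 (f := rest) (P := fun y => y < 2^-1)).
    apply: cvgM; last exact: dseq_continuous dM Nb.
    exact: (dseq_continuous (j := 0) dc).
  by rewrite /rest gamma_coef_00 mul0r; apply: lt_nbhsl; lra.
have /nbhs_ballP[d d0 hd] :
    \forall s \near (0 : R), [/\ 2^-1 < gamma_coef_seq a 1 s, gamma_coef0 a s < 2 & rest s < 2^-1].
  by near=> s; split; near: s.
(* 1 / 8: the estimates above bound each of three factors by 1 / 2 *)
apply: (RL_not_exists (k := 8^-1) nu1 nuZ _ d0 p0) => // s /andP[s0 sd].
have [] := hd s; first by rewrite /ball/= sub0r normrN gtr0_norm.
rewrite (gamma_coef_seq1 a0 s0) mixture_complement// {1}/gamma_coef.
have c0 : 0 < gamma_coef0 a s.
  by rewrite divr_gt0 ?expR_gt0// Gamma_fun_gt0// addr_gt0.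
set X := ln a - _; set Y := gamma_coef0 a s => x1 x2 x3.
rewrite ler_pdivrMr//.
have X0 : 0 < X * s by rewrite -(pmulr_lgt0 _ c0) -mulrA (lt_trans _ x1).
have x4 : 4^-1 < X * s.
  rewrite ltNge; apply/negP => hx.
  have : X * s * Y <= 4^-1 * 2 by rewrite ler_pM// ltW.
  by move: x1; rewrite -mulrA; lra.
rewrite mulrAC.
have -> : 8^-1 = 4^-1 * 2^-1 :> R by field.
by rewrite ler_pM// ?ltW//; lra.
Unshelve. all: by end_near. Qed.

End mixture_singular.

(** * The space fractional Polya process *)

Theorem theorem5p4 (R : realType) (d : measure_display) (T : measurableType d)
  (P : probability T R) (nu beta alpha t : R) (n : nat)
  (D : R -> {RV P >-> R}) (N : R -> R -> {RV P >-> nat})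
  (Gam : R -> {RV P >-> R})
  (hnu : 0 <= nu) (hbeta0 : 0 < beta) (hbeta1 : beta <= 1)
  (halpha : 0 < alpha) (ht : 0 <= t)
  (hD : stable_subordinator beta D)
  (hN : forall lambda : R, 0 < lambda ->
          poisson_process lambda (fun s => N s lambda))
  (hNm : jointly_measurable_field N)
  (hGam : forall p : R, 0 < p -> gamma_distributed alpha p (Gam p))
  (hind : forall p : R, 0 < p ->
     independent3 P
       (family_generators [set s : R | 0 <= s] (fun s => D s : T -> R))
       (N_generators N)
       (family_generators [set p] (fun q => Gam q : T -> R))) :
  let ptilde (s lambda : R) : R := pmf_at P (sf_poisson D N s lambda) n in
  let eta (s p : R) : R := pmf_at P (sf_polya D N (Gam p) s) n in
  let F (p : R) : R := (ln alpha - digamma p) * eta t p in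
  let K (p lambda : R) : R :=
    ptilde t lambda * ln lambda *
    RL_deriv (nu - 1) (fun q => gamma_density lambda alpha q) p in
  let rhs_defined (p : R) : Prop :=
    [/\ RL_exists (nu - 1) F p,
        forall lambda : R, 0 < lambda ->
          RL_exists (nu - 1) (fun q => gamma_density lambda alpha q) p &
        lebesgue_measure.-integrable `]0, +oo[
          (fun lambda : R => (K p lambda)%:E)] in
  forall p : R, 0 < p ->
    [/\ rhs_defined p <-> (0 < n)%N \/ (exists m : nat, nu = m.+1%:R),
        rhs_defined p ->
          RL_exists nu (eta t) p /\
          RL_deriv nu (eta t) p =
            RL_deriv (nu - 1) F p +
            \int[lebesgue_measure]_(lambda in `]0, +oo[) K p lambda &
        eta 0 p = (n == 0%N)%:R].
Proof.
move=> ptilde eta F K rhs_defined p p0.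
have mt s k : measurable_fun [set` (`]0, +oo[ : interval R)]
    (fun l => pmf_at P (sf_poisson D N s l) k).
  exact: measurable_funTS (measurable_sf_poisson_pmf s k D hNm).
have pt0 s l : 0 <= ptilde s l := sf_poisson_pmf_ge0 s n D N l.
have pt1 s l : ptilde s l <= 1 := sf_poisson_pmf_le1 s n D hNm l.
have etaE s q : 0 <= s -> 0 < q -> eta s q =
    \int[lebesgue_measure]_(l in [set` (`]0, +oo[ : interval R)])
      (ptilde s l * gamma_density l alpha q).
  by move=> s0 q0; have := sf_polya_mixture n s0 hNm hGam hind q0.
have mass q : 0 < q ->
    \int[lebesgue_measure]_(l in [set` (`]0, +oo[ : interval R)])
      gamma_density l alpha q = 1.
  by move=> q0; have := gamma_density_mass hGam q0.
have b0 : 0 <= beta := ltW hbeta0.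
have upper s l : (0 < n)%N -> 0 <= s -> 0 < l -> `|ptilde s l| <= s * l `^ beta.
  by move=> n0 s0 l0; rewrite ger0_norm//; have := sf_poisson_pmfS_upper s0 hD hN hNm hind n0 l0.
have lower s l : n = 0%N -> 0 <= s -> 0 < l -> `|1 - ptilde s l| <= s * l `^ beta.
  move=> n0 s0 l0; rewrite ger0_norm ?subr_ge0// lerBlDr addrC -lerBlDr.
  by have := sf_poisson_pmf0_lower s0 hD hN hNm hind n0 l0.
(* the bound for integer orders, where n may be 0 *)
have bounded s l : 0 < l -> `|ptilde s l| <= 1 * l `^ 0.
  by move=> l0; rewrite powRr0 mulr1 ger0_norm.
have int_order m : nu = m.+1%:R -> [/\ rhs_defined p, RL_exists nu (eta t) p &
    RL_deriv nu (eta t) p = RL_deriv (nu - 1) F p +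
      \int[lebesgue_measure]_(lambda in `]0, +oo[) K p lambda].
  move=> nuE; have nuE1 : nu - 1 = m%:R by rewrite nuE -natr1 addrK.
  rewrite /rhs_defined /K nuE1 nuE.
  exact: (mixture_equation_nat halpha (lexx 0) ler01 ler01 (mt t n) (bounded t)
    (etaE t ^~ ht) m p0).
have frac_order : (0 < n)%N -> nu = 0 \/ nu != (Num.truncn nu)%:R ->
    [/\ rhs_defined p, RL_exists nu (eta t) p &
    RL_deriv nu (eta t) p = RL_deriv (nu - 1) F p +
      \int[lebesgue_measure]_(lambda in `]0, +oo[) K p lambda].
  move=> n0 nuZ.
  exact: (mixture_equation_frac halpha b0 hbeta1 ht (mt t n)
    (fun l => upper t l n0 ht) (etaE t ^~ ht) hbeta0 hnu nuZ p0).
have order_cases : (exists m : nat, nu = m.+1%:R) \/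
    (nu = 0 \/ nu != (Num.truncn nu)%:R).
  have [nuE|] := eqVneq nu (Num.truncn nu)%:R; last by right; right.
  case: (Num.truncn nu) nuE => [|m] nuE; [by right; left|by left; exists m].
have defined : (0 < n)%N \/ (exists m : nat, nu = m.+1%:R) ->
    [/\ rhs_defined p, RL_exists nu (eta t) p &
    RL_deriv nu (eta t) p = RL_deriv (nu - 1) F p +
      \int[lebesgue_measure]_(lambda in `]0, +oo[) K p lambda].
  move=> [n0|[m nuE]]; last exact: int_order nuE.
  by case: order_cases => [[m nuE]|nuZ]; [exact: int_order nuE|exact: frac_order].
have undefined : rhs_defined p -> (0 < n)%N \/ (exists m : nat, nu = m.+1%:R).
  move=> [F_exists _ _]; have [n0|n0] := posnP n; last by left.
  case: order_cases => [|nuZ]; [by right|exfalso].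
  have nu1 : -1 <= nu - 1 by rewrite lerBrDr addNr.
  have h1 l : 0 < l -> `|ptilde t l| <= 1 by move=> _; rewrite ger0_norm.
  exact: (mixture_singular halpha hbeta0 ht (mt t n) h1 (fun l => lower t l n0 ht) mass
    (etaE t ^~ ht) nu1 (nonint_pred nuZ) p0) F_exists.
split.
- split; first exact: undefined.
  by move=> /defined[].
- by move=> /undefined/defined[].
rewrite etaE//.
have pt00 l : 0 < l -> ptilde 0 l = (n == 0%N)%:R.
  move=> l0; have [n0|n0] := posnP n.
    have := lower 0 l n0 (lexx 0) l0; rewrite mul0r normr_le0 subr_eq0 => /eqP <-.
    by [].
  have := upper 0 l n0 (lexx 0) l0; rewrite mul0r normr_le0 => /eqP ->.
  by [].
transitivity (\int[lebesgue_measure]_(l in [set` (`]0, +oo[ : interval R)])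
    ((n == 0%N)%:R * gamma_density l alpha p)).
  by apply: eq_Rintegral => l; rewrite inE/= in_itv/= andbT => l0; rewrite pt00.
case: eqP => _.
  by rewrite -[RHS](mass p p0); apply: eq_Rintegral => l _; rewrite mul1r.
by rewrite /Rintegral integral0_eq// => l _; rewrite mul0r.
Qed.
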